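(* Let $(\mathbb{Z},\boldsymbol{\preccurlyeq}_{231})$ be the random total order on $\mathbb{Z}$ constructed in the context, and let $\boldsymbol{\sigma}^\infty_{231}$ be a random infinite rooted permutation whose law $\mathcal{L}(\boldsymbol{\sigma}^\infty_{231})$ is the quenched Benjamini--Schramm limit of a sequence $(\boldsymbol{\sigma}^n)_{n\in\mathbb{Z}_{>0}}$ of uniform random permutations in $\mathrm{Av}^n(231)$. Then $$(\mathbb{Z},\boldsymbol{\preccurlyeq}_{231})\stackrel{(d)}{=}\boldsymbol{\sigma}^\infty_{231}.$$
   Context: All intervals $[a,b]$ are integer intervals. $\mathcal{S}^n$ is the set of permutations $\sigma=\sigma_1\cdots\sigma_n$ of $[n]=\{1,\dots,n\}$, $|\sigma|=n$ is the size, and $\mathcal{S}^0=\{\emptyset\}$ contains the empty permutation. $\mathrm{Av}^n(231)$ is the set of permutations in $\mathcal{S}^n$ having no subsequence $\sigma_a,\sigma_b,\sigma_c$ with $a<b<c$ and $\sigma_c<\sigma_a<\sigma_b$; $\mathrm{Av}(231)=\bigcup_{n\ge1}\mathrm{Av}^n(231)$. Rooted permutations. A finite rooted permutation is a pair $(\sigma,i)$ with $\sigma\in\mathcal{S}^n$, $n\ge1$, $i\in[n]$. It is identified with the pair $(A_{\sigma,i},\preccurlyeq_{\sigma,i})$, where $A_{\sigma,i}=[-i+1,|\sigma|-i]$ and $\preccurlyeq_{\sigma,i}$ is the total order on it given by $\ell\preccurlyeq_{\sigma,i}j\iff\sigma_{\ell+i}\le\sigma_{j+i}$; this is a bijection between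 finite rooted permutations and total orders on finite integer intervals containing $0$. An infinite rooted permutation is a pair $(A,\preccurlyeq)$ with $A$ an infinite integer interval containing $0$ and $\preccurlyeq$ a total order on $A$. $\tilde{\mathcal{S}}_\bullet$ is the set of all finite and infinite rooted permutations. For $h\in\mathbb{Z}_{>0}$, $r_h(A,\preccurlyeq)=(A\cap[-h,h],\preccurlyeq)$. The local distance on $\tilde{\mathcal{S}}_\bullet$ is $d(x,y)=2^{-\sup\{h\in\mathbb{Z}_{>0}:\,r_h(x)=r_h(y)\}}$, with $\sup\emptyset=0$, $\sup\mathbb{Z}_{>0}=+\infty$, $2^{-\infty}=0$. Quenched convergence: for a permutation $\sigma$, let $\mu_\sigma$ be the law of $(\sigma,\boldsymbol{i})$ with $\boldsymbol{i}$ uniform in $[|\sigma|]$. A sequence $(\boldsymbol{\sigma}^n)$ of random permutations converges in the quenched Benjamini--Schramm sense to a probability measure $\mu$ on $\tilde{\mathcal{S}}_\bullet$ if the random measures $\mu_{\boldsymbol{\sigma}^n}$ converge in distribution to $\mu$ with respect to the weak topology on probability measures on $(\tilde{\mathcal{S}}_\bullet,d)$. (For uniform permutations in $\mathrm{Av}^n(231)$ such a deterministic limit exists and is the law of a random infinite rooted permutation.) Construction of $(\mathbb{Z},\boldsymbol{\preccurlyeq}_{231})$. For a finite rooted permutation $(\sigma,i)$ with $|\sigma|=k>0$ and $\pi\in\mathcal{S}^\ell$, $\ell\ge0$, set $(\sigma,i)*^R\pi=\big(\sigma_1\dots\sigma_k\,(\ell+k+1)\,(\pi_1+k)\dots(\pi_\ell+k),\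 i\big)$ and $(\sigma,i)*^L\pi=\big(\pi_1\dots\pi_\ell\,(\ell+k+1)\,(\sigma_1+\ell)\dots(\sigma_k+\ell),\ \ell+i+1\big)$. Let $(\boldsymbol{S}^i)_{i\ge0}$ be i.i.d. random variables with values in $\mathrm{Av}(231)\cup\{\emptyset\}$ with $\mathbb{P}(\boldsymbol{S}^i=\pi)=\frac12\big(\frac14\big)^{|\pi|}$ for $\pi\in\mathrm{Av}(231)$ and $\mathbb{P}(\boldsymbol{S}^i=\emptyset)=\frac12$. Let $(\boldsymbol{X}_i)_{i\ge1}$ be i.i.d., independent of $(\boldsymbol{S}^i)$, with $\mathbb{P}(\boldsymbol{X}_i=R)=\mathbb{P}(\boldsymbol{X}_i=L)=\frac12$. Let $\tilde{\boldsymbol{S}}^0$ be $\boldsymbol{S}^0$ conditioned to be non-empty, and $\tilde{\boldsymbol{S}}^0_\bullet=(\tilde{\boldsymbol{S}}^0,\boldsymbol{m})$ with $\boldsymbol{m}$ the index of the maximum of $\tilde{\boldsymbol{S}}^0$. For $n\ge1$ let $\boldsymbol{\sigma}^n_\bullet=((\dots((\tilde{\boldsymbol{S}}^0_\bullet*^{\boldsymbol{X}_1}\boldsymbol{S}^1)*^{\boldsymbol{X}_2}\boldsymbol{S}^2)\dots)*^{\boldsymbol{X}_n}\boldsymbol{S}^n)$. For every $h\in\mathbb{Z}_{>0}$ the sequence $(r_h(\boldsymbol{\sigma}^n_\bullet))_{n}$ is almost surely eventually constant, and almost surely there is a unique total order $\boldsymbol{\preccurlyeq}_{231}$ on $\mathbb{Z}$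 such that $r_h(\mathbb{Z},\boldsymbol{\preccurlyeq}_{231})=\lim_{n\to\infty}r_h(\boldsymbol{\sigma}^n_\bullet)$ for all $h\in\mathbb{Z}_{>0}$. *)

(* Defs.v *)
From HB Require Import structures.
From mathcomp Require Import all_boot all_order all_algebra finmap.
From mathcomp Require Import all_classical all_reals all_analysis.

Set Implicit Arguments.
Unset Strict Implicit.
Unset Printing Implicit Defensive.

Import Order.TTheory GRing.Theory Num.Theory.
Import numFieldTopology.Exports.

Local Open Scope classical_set_scope.
Local Open Scope ring_scope.

(* Permutations are one-line words: sigma = [:: sigma_1; ...; sigma_n] is a
   rearrangement of [:: 1; ...; n]. Words are used instead of 'S_n because the
   constructions below concatenate permutations of different sizes. Positions
   are numbered from 0, so sigma_k is [nth 0 sigma k.-1]. *)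
Definition is_perm_word (s : seq nat) : bool := perm_eq s (iota 1 (size s)).

Record permutation := Permutation {
  pword :> seq nat ;
  pwordP : is_perm_word pword }.

HB.instance Definition _ := [isSub for pword].
HB.instance Definition _ := [Countable of permutation by <:].

Definition empty_perm : permutation := @Permutation [::] isT.
Definition one_perm : permutation := @Permutation [:: 1%N] isT.

HB.instance Definition _ := isPointed.Build permutation empty_perm.
HB.instance Definition _ := @isMeasurable.Build default_measure_display
  permutation discrete_measurable discrete_measurable0
  discrete_measurableC discrete_measurableU.

Definition nonempty_perm : Type := {s : permutation | pword s != [::]}.

HB.instance Definition _ := Countable.on nonempty_perm.
HB.instance Definition _ :=
  isPointed.Build nonempty_perm (exist _ one_perm isT).
HB.instance Definition _ := @isMeasurable.Build default_measure_display
  nonempty_perm discrete_measurable discrete_measurable0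
  discrete_measurableC discrete_measurableU.

Definition avoids231 (s : seq nat) : Prop :=
  forall a b c : nat, (a < b < c)%N -> (c < size s)%N ->
    ~ (nth 0 s c < nth 0 s a < nth 0 s b)%N.

Definition Av231n (n : nat) : set permutation :=
  [set s | size s = n /\ avoids231 s].

Definition Av231 : set permutation := \bigcup_(n in [set n | (0 < n)%N]) Av231n n.

Lemma finite_Av231n n : finite_set (Av231n n).
Proof.
have mem_perms (s : permutation) :
    size s = n -> pword s \in permutations (iota 1 n).
  by move=> <-; rewrite mem_permutations; exact: pwordP.
pose f (w : seq nat) : permutation := insubd empty_perm w.
apply: (@sub_finite_set _ _ (f @` [set` permutations (iota 1 n)])).
  move=> s [sn _]; exists (pword s); first exact: mem_perms.
  by rewrite /f /insubd valK.
by apply: finite_image; exact: finite_seq.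
Qed.

Definition finite_rooted : Type := {s : permutation & 'I_(size s)}.

(* [rooted_at sigma i] is the finite rooted permutation (sigma, i+1). *)
Definition rooted_at (s : permutation) (i : 'I_(size s)) : finite_rooted :=
  existT (fun t : permutation => 'I_(size t)) s i.

Lemma is_perm_word_join_max (s p : permutation) :
  is_perm_word (s ++ (size p + size s + 1)%N :: map (addn (size s)) p).
Proof.
rewrite /is_perm_word size_cat [size (_ :: _)]/= size_map iotaD.
apply: perm_cat; first exact: pwordP.
rewrite -[(size p).+1]addn1 iotaD perm_sym perm_catC.
have -> : iota (1 + size s + size p) 1 = [:: (size p + size s + 1)%N].
  by rewrite /= addn1 add1n addSn addnC.
rewrite cat_cons cat0s perm_cons perm_sym addnC iotaDl.
by apply: perm_map; exact: pwordP.
Qed.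

Definition join_max (s p : permutation) : permutation :=
  Permutation (is_perm_word_join_max s p).

Lemma join_max_ltnl (s p : permutation) (i : 'I_(size s)) : (i < size (join_max s p))%N.
Proof. by rewrite /= size_cat (leq_trans (ltn_ord i)) ?leq_addr. Qed.

Lemma join_max_ltnr (s p : permutation) (i : 'I_(size s)) :
  (size p + i + 1 < size (join_max p s))%N.
Proof. by rewrite /= size_cat /= size_map addn1 addnS ltnS ltn_add2l. Qed.

Definition glueR (x : finite_rooted) (p : permutation) : finite_rooted :=
  let: existT s i := x in
  @rooted_at (join_max s p) (Ordinal (join_max_ltnl p i)).

(* The word of the left gluing pi_1...pi_l (l+k+1) (sigma_1+l)...(sigma_k+l) is
   [join_max pi sigma]; only the root differs. *)
Definition glueL (x : finite_rooted) (p : permutation) : finite_rooted :=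
  let: existT s i := x in
  @rooted_at (join_max p s) (Ordinal (join_max_ltnr p i)).

(* [true] stands for R and [false] for L. *)
Definition glue (b : bool) : finite_rooted -> permutation -> finite_rooted :=
  if b then glueR else glueL.

Definition perm_max (s : seq nat) : nat := \max_(k <- s) k.

Lemma perm_max_ltn (s : nonempty_perm) :
  (index (perm_max (val s)) (val s) < size (val s))%N.
Proof.
rewrite index_mem; case: s => -[s /= _].
elim: s => [//|x [|y s] IHs] _; first by rewrite /perm_max big_seq1 inE eqxx.
rewrite /perm_max big_cons inE; have := IHs isT; rewrite -/(perm_max (y :: s)).
set m := perm_max _ => ms.
by case: (leqP m x) => [_|_]; rewrite ?eqxx // ms orbT.
Qed.

Definition root_at_max (s : nonempty_perm) : finite_rooted :=
  @rooted_at (val s) (Ordinal (perm_max_ltn s)).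

(* [x i] is X_{i+1}, since the X_i are numbered from 1. *)
Fixpoint glue_iter (s0 : nonempty_perm) (s : nat -> permutation)
    (x : nat -> bool) (n : nat) : finite_rooted :=
  if n is m.+1 then glue (x m) (glue_iter s0 s x m) (s m.+1)
  else root_at_max s0.

(* The relation is required to hold inside A only, so that Leibniz equality of
   records is equality of the pairs (A, preceq); reflexivity on A is the
   diagonal case of totality. *)
Record rooted_perm := RootedPerm {
  rp_dom : set int ;
  rp_le : int -> int -> Prop ;
  rp_dom0 : rp_dom 0 ;
  rp_dom_itv : forall x y z, rp_dom x -> rp_dom z -> x <= y <= z -> rp_dom y ;
  rp_le_dom : forall x y, rp_le x y -> rp_dom x /\ rp_dom y ;
  rp_le_anti : forall x y, rp_le x y -> rp_le y x -> x = y ;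
  rp_le_trans : forall x y z, rp_le x y -> rp_le y z -> rp_le x z ;
  rp_le_total : forall x y, rp_dom x -> rp_dom y -> rp_le x y \/ rp_le y x }.

Lemma rooted_perm_eq (x y : rooted_perm) :
  rp_dom x = rp_dom y -> rp_le x = rp_le y -> x = y.
Proof.
case: x => A l a1 a2 a3 a4 a5 a6; case: y => B m b1 b2 b3 b4 b5 b6 /= AB lm.
by subst B m; congr RootedPerm; exact: Prop_irrelevance.
Qed.

Section of_finite.
Variables (s : permutation) (i : 'I_(size s)).

(* With iota = i+1 the root in 1-based numbering, this is
   A_{sigma,iota} = [-iota+1, |sigma|-iota]. *)
Definition of_finite_dom : set int :=
  [set x : int | (- (i%:Z) <= x) && (x < (size s)%:Z - i%:Z)].

Definition of_finite_val (x : int) : nat := nth 0 s (absz (x + i%:Z)).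

Definition of_finite_le (x y : int) : Prop :=
  [/\ of_finite_dom x, of_finite_dom y
    & (of_finite_val x <= of_finite_val y)%N].

Let dom0 : of_finite_dom 0.
Proof. by rewrite /of_finite_dom /= oppr_le0 subr_gt0 ltz_nat ltn_ord. Qed.

Let dom_itv x y z :
  of_finite_dom x -> of_finite_dom z -> x <= y <= z -> of_finite_dom y.
Proof.
move=> /andP[ix _] /andP[_ zi] /andP[xy yz]; apply/andP; split.
  exact: le_trans xy.
exact: le_lt_trans zi.
Qed.

Let le_dom x y : of_finite_le x y -> of_finite_dom x /\ of_finite_dom y.
Proof. by case. Qed.

Let le_anti x y : of_finite_le x y -> of_finite_le y x -> x = y.
Proof.
move=> [/andP[x0 xs] /andP[y0 ys] xy] [_ _ yx].
have ge0 z : - (i%:Z) <= z -> 0 <= z + i%:Z by rewrite -lerBlDr sub0r.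
have lts z : - (i%:Z) <= z -> z < (size s)%:Z - i%:Z ->
    (absz (z + i%:Z)%R < size s)%N.
  by move=> z0; rewrite ltrBrDr -ltz_nat gez0_abs ?ge0.
have us : uniq s by rewrite (perm_uniq (pwordP s)) iota_uniq.
have : of_finite_val x = of_finite_val y by apply/eqP; rewrite eqn_leq xy yx.
move/eqP; rewrite nth_uniq ?lts // => /eqP xyi.
apply: (@addIr _ i%:Z).
by rewrite -(gez0_abs (ge0 _ x0)) -(gez0_abs (ge0 _ y0)) xyi.
Qed.

Let le_tr x y z : of_finite_le x y -> of_finite_le y z -> of_finite_le x z.
Proof. by move=> [? _ xy] [_ ? yz]; split=> //; exact: leq_trans yz. Qed.

Let le_tot x y :
  of_finite_dom x -> of_finite_dom y -> of_finite_le x y \/ of_finite_le y x.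
Proof.
by move=> dx dy; case/orP: (leq_total (of_finite_val x) (of_finite_val y));
  [left|right].
Qed.

Definition of_finite_def : rooted_perm :=
  RootedPerm dom0 dom_itv le_dom le_anti le_tr le_tot.

End of_finite.

Definition of_finite (x : finite_rooted) : rooted_perm :=
  of_finite_def (projT2 x).

Section restriction.
Variables (h : nat) (x : rooted_perm).

Definition restr_dom : set int :=
  [set z | rp_dom x z /\ - (h%:Z) <= z <= h%:Z].

Definition restr_le (y z : int) : Prop :=
  [/\ restr_dom y, restr_dom z & rp_le x y z].

Let dom0 : restr_dom 0.
Proof. by split; [exact: rp_dom0|rewrite oppr_le0 lez_nat leq0n]. Qed.

Let dom_itv a b c :
  restr_dom a -> restr_dom c -> a <= b <= c -> restr_dom b.
Proof.
move=> [xa /andP[ha _]] [xc /andP[_ ch]] abc; split.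
  exact: rp_dom_itv abc.
by case/andP: abc => ab bc; rewrite (le_trans ha ab) (le_trans bc ch).
Qed.

Let le_dom a b : restr_le a b -> restr_dom a /\ restr_dom b.
Proof. by case. Qed.

Let le_anti a b : restr_le a b -> restr_le b a -> a = b.
Proof. by move=> [_ _ ab] [_ _]; exact: rp_le_anti. Qed.

Let le_tr a b c : restr_le a b -> restr_le b c -> restr_le a c.
Proof. by move=> [? _ ab] [_ ? bc]; split=> //; exact: rp_le_trans bc. Qed.

Let le_tot a b : restr_dom a -> restr_dom b -> restr_le a b \/ restr_le b a.
Proof.
by move=> da db; case: (rp_le_total da.1 db.1); [left|right].
Qed.

Definition restr : rooted_perm :=
  RootedPerm dom0 dom_itv le_dom le_anti le_tr le_tot.

End restriction.

Lemma restr_le_agree h h' x y :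
  (h <= h')%N -> restr h' x = restr h' y -> restr h x = restr h y.
Proof.
move=> hh' xy.
have restrK z : restr h z = restr h (restr h' z).
  have sub u : - (h%:Z) <= u <= h%:Z -> - (h'%:Z) <= u <= h'%:Z.
    move=> /andP[hu uh]; rewrite (le_trans _ hu) ?lerN2 ?lez_nat //.
    by rewrite (le_trans uh) ?lez_nat.
  apply: rooted_perm_eq.
    apply/seteqP; split=> u /=; last by move=> [[]].
    by move=> [zu hu]; split=> //; split=> //; exact: sub.
  apply/funext => u; apply/funext => v; apply/propext; split.
    move=> [[zu hu] [zv hv] uv].
    by do 3?[split] => //; exact: sub.
  by move=> [[[zu _] hu] [[zv _] hv] [_ _ uv]].
by rewrite restrK xy -restrK.
Qed.

Lemma restr_ext x y : (forall h, (0 < h)%N -> restr h x = restr h y) -> x = y.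
Proof.
move=> xy.
have in_itv (u v : int) : exists2 h, (0 < h)%N &
    (- (h%:Z) <= u <= h%:Z) /\ (- (h%:Z) <= v <= h%:Z).
  exists (absz u + absz v).+1 => //; rewrite -!ler_norml -!abszE !lez_nat.
  by split; rewrite leqW // ?leq_addr ?leq_addl.
apply: rooted_perm_eq.
  apply/funext => u; apply/propext.
  have [h h0 [hu _]] := in_itv u u.
  have /(congr1 (fun z => rp_dom z u))/= := xy _ h0; rewrite /restr_dom /=.
  move=> E; split=> ux.
    by suff [] : rp_dom y u /\ - h%:Z <= u <= h%:Z by []; rewrite -E.
  by suff [] : rp_dom x u /\ - h%:Z <= u <= h%:Z by []; rewrite E.
apply/funext => u; apply/funext => v; apply/propext.
have [h h0 [hu hv]] := in_itv u v.
have /(congr1 (fun z => rp_le z u v))/= E := xy _ h0.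
by split=> uv; have [du dv] := rp_le_dom uv;
  [suff [] : restr_le h y u v by []; rewrite -E
  |suff [] : restr_le h x u v by []; rewrite E].
Qed.

HB.instance Definition _ := gen_eqMixin rooted_perm.
HB.instance Definition _ := gen_choiceMixin rooted_perm.

Section usual_order.
Let dom0 : [set: int] 0. Proof. by []. Qed.
Let dom_itv (x y z : int) :
  [set: int] x -> [set: int] z -> x <= y <= z -> [set: int] y.
Proof. by []. Qed.
Let le_dom (x y : int) : x <= y -> [set: int] x /\ [set: int] y.
Proof. by []. Qed.
Let le_anti' (x y : int) : x <= y -> y <= x -> x = y.
Proof. by move=> xy yx; apply/le_anti; rewrite xy. Qed.
Let le_tr (x y z : int) : x <= y -> y <= z -> x <= z.
Proof. exact: le_trans. Qed.
Let le_tot (x y : int) : [set: int] x -> [set: int] y -> x <= y \/ y <= x.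
Proof. by move=> _ _; exact/orP/le_total. Qed.
Definition usual_order : rooted_perm :=
  RootedPerm dom0 dom_itv le_dom le_anti' le_tr le_tot.
End usual_order.

HB.instance Definition _ := isPointed.Build rooted_perm usual_order.

Section local_distance.
Context {R : realType}.
Implicit Types x y z : rooted_perm.

(* The maximum with 0 implements the convention sup set0 = 0 (in [\bar R] the
   supremum of the empty set is -oo). *)
Definition agreement x y : \bar R :=
  Order.max 0%E
    (ereal_sup [set h%:R%:E | h in [set h | (0 < h)%N /\ restr h x = restr h y]]).

Definition local_dist x y : R :=
  if agreement x y is r%:E then 2 `^ (- r) else 0.

Lemma local_dist_cases x y :
  x = y /\ local_dist x y = 0 \/
  exists2 k : nat,
    (forall h, (0 < h)%N -> restr h x = restr h y <-> (h <= k)%N) &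
    local_dist x y = 2 `^ (- k%:R).
Proof.
have [xy|/existsNP[h1 /not_implyP[h1_gt0 h1xy]]] :=
    pselect (forall h, (0 < h)%N -> restr h x = restr h y).
  left; split; first exact: restr_ext.
  rewrite /local_dist (_ : agreement x y = +oo%E) //.
  rewrite /agreement (_ : ereal_sup _ = +oo%E) ?maxey //.
  apply/eq_infty => r.
  have rn : (r%:E <= (Num.truncn `|r|).+1%:R%:E)%E.
    by rewrite lee_fin (le_trans (ler_norm r)) // ltW // truncnS_gt.
  apply: le_trans rn _; apply: ereal_sup_ubound.
  by exists (Num.truncn `|r|).+1 => //; split=> //; exact: xy.
right; pose Q h := `[< (0 < h)%N /\ restr h x <> restr h y >].
have exQ : exists h, Q h by exists h1; apply/asboolP.
case: (ex_minnP exQ) => -[|k] /asboolP[// _ kxy] kmin.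
have kP h : (0 < h)%N -> restr h x = restr h y <-> (h <= k)%N.
  move=> h0; split=> hxy.
    rewrite leqNgt; apply/negP => kh; apply: kxy.
    exact: restr_le_agree hxy.
  apply: contrapT => nhxy; have : Q h by apply/asboolP.
  by move/kmin; rewrite leqNgt ltnS hxy.
exists k => //; rewrite /local_dist (_ : agreement x y = k%:R%:E) //.
apply/eqP; rewrite eq_le; apply/andP; split.
  rewrite ge_max lee_fin ler0n /=; apply: ge_ereal_sup => _ /= [h [h0 hxy] <-].
  by rewrite lee_fin ler_nat; exact/kP.
rewrite le_max; case: (posnP k) => [->|k0]; first by rewrite lexx.
apply/orP; right; apply: ereal_sup_ubound; exists k => //; split=> //.
exact/kP.
Qed.

Let pow_gt0 (k : nat) : 0 < 2 `^ (- k%:R) :> R.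
Proof. exact: powR_gt0. Qed.

Lemma local_distxx x : local_dist x x = 0.
Proof.
case: (local_dist_cases x x) => [[_ ->//]|[k kP _]].
by have [/(_ erefl)] := kP k.+1 isT; rewrite ltnn.
Qed.

Lemma local_dist_eq0 x y : local_dist x y = 0 -> x = y.
Proof.
case: (local_dist_cases x y) => [[//]|[k _ -> k0]].
by have := pow_gt0 k; rewrite k0 ltxx.
Qed.

Lemma local_dist_sym x y : local_dist x y = local_dist y x.
Proof.
rewrite /local_dist /agreement.
suff -> : [set h | (0 < h)%N /\ restr h x = restr h y] =
          [set h | (0 < h)%N /\ restr h y = restr h x] by [].
by apply/seteqP; split=> h [h0 xy]; split.
Qed.

Lemma local_dist_triangle y x z :
  local_dist x z <= local_dist x y + local_dist y z.
Proof.
case: (local_dist_cases x y) => [[-> _]|[k kP dk]].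
  by rewrite local_distxx add0r.
case: (local_dist_cases y z) => [[<- _]|[l lP dl]].
  by rewrite local_distxx addr0.
case: (local_dist_cases x z) => [[_ ->]|[m mP dm]].
  by rewrite dk dl addr_ge0 // ltW.
have [km|mk] := leqP k m.
  apply: (@le_trans _ _ (local_dist x y)); last by rewrite dl lerDl ltW.
  by rewrite dm dk ler_powR ?ler1n // lerN2 ler_nat.
apply: (@le_trans _ _ (local_dist y z)); last by rewrite dk lerDr ltW.
rewrite dm dl ler_powR ?ler1n // lerN2 ler_nat leqNgt; apply/negP => ml.
have xz : restr m.+1 x = restr m.+1 z.
  by transitivity (restr m.+1 y); [exact/kP|exact/lP].
by move: xz => /(mP m.+1 (ltn0Sn m)); rewrite ltnn.
Qed.

End local_distance.

(* The local distance is real-valued, so the metric structure depends on the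
   choice of the type R of real numbers. *)
Definition rooted_space (R : realType) : Type := rooted_perm.

HB.instance Definition _ (R : realType) := Pointed.copy (rooted_space R) rooted_perm.
HB.instance Definition _ (R : realType) :=
  @isMetric.Build R (rooted_space R) local_dist local_distxx local_dist_eq0
    local_dist_sym local_dist_triangle.

Definition borel (T : ptopologicalType) := g_sigma_algebraType (@open T).

HB.instance Definition _ (T : ptopologicalType) := Measurable.on (borel T).

Section weak_topology.
Context (T : ptopologicalType) (R : realType).

Definition bounded_continuous (E : topologicalType) : set (E -> R) :=
  [set f | continuous f /\ exists M : R, forall x, `|f x| <= M].

Definition integrals (nu : probability (borel T) R)
    (f : {f : T -> R | bounded_continuous f}) : R :=
  \int[nu]_x sval f x.

(* The coarsest topology making nu |-> \int[nu]_x f x continuous for every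
   bounded continuous f. *)
Definition weak_prob : topologicalType :=
  initial_topology (integrals : probability (borel T) R ->
    {ptws {f : T -> R | bounded_continuous f} -> R^o}).

End weak_topology.

Section rooting_law.
Context (R : realType) (s : nonempty_perm).
Local Open Scope ereal_scope.
Let n := size (val s).

(* mu_sigma, the law of (sigma, i) with i uniform in [|sigma|]. *)
Definition rooting_law (B : set (borel (rooted_space R))) : \bar R :=
  (n%:R^-1)%:E * \sum_(i < n)
    \d_(of_finite (@rooted_at (val s) i) : borel (rooted_space R)) B.

Let d (k : nat) : {measure set (borel (rooted_space R)) -> \bar R} :=
  if insub k is Some i
  then \d_(of_finite (@rooted_at (val s) i) : borel (rooted_space R))
  else mzero.

Let rooting_lawE B :
  rooting_law B = mscale (n%:R^-1%:nng : {nonneg R})%R (msum d n) B.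
Proof.
rewrite /mscale /= /msum /=; congr (_ * _); apply: eq_bigr => i _.
by rewrite /d valK.
Qed.

Let rooting_law0 : rooting_law set0 = 0.
Proof. by rewrite rooting_lawE measure0. Qed.

Let rooting_law_ge0 B : 0 <= rooting_law B.
Proof. by rewrite rooting_lawE measure_ge0. Qed.

Let rooting_law_sigma_additive : semi_sigma_additive rooting_law.
Proof.
rewrite (_ : rooting_law = mscale (n%:R^-1%:nng : {nonneg R})%R (msum d n)).
  exact: measure_semi_sigma_additive.
by apply/funext => B; exact: rooting_lawE.
Qed.

HB.instance Definition _ := isMeasure.Build _ _ _ rooting_law
  rooting_law0 rooting_law_ge0 rooting_law_sigma_additive.

Let rooting_law_setT : rooting_law setT = 1.
Proof.
rewrite /rooting_law.
under eq_bigr do rewrite diracT.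
rewrite sumEFin sumr_const card_ord -EFinM mulVf //.
by rewrite pnatr_eq0 size_eq0; exact: valP s.
Qed.

HB.instance Definition _ :=
  Measure_isProbability.Build _ _ _ rooting_law rooting_law_setT.

End rooting_law.

Arguments rooting_law R s B : clear implicits.

(* Convergence in distribution of random elements of E to a constant. *)
Definition cvg_in_distribution_cst (R : realType) d (T : measurableType d)
    (P : probability T R) (E : topologicalType) (Y : nat -> T -> E) (c : E) :=
  forall F : E -> R, bounded_continuous F ->
    (fun n => \int[P]_w F (Y n w)) @ \oo --> F c.

Definition quenched_BS_cvg (R : realType) d (T : measurableType d)
    (P : probability T R) (sigma : nat -> T -> nonempty_perm)
    (mu : probability (borel (rooted_space R)) R) :=
  @cvg_in_distribution_cst R d T P (weak_prob (rooted_space R) R)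
    (fun n w => rooting_law R (sigma n w) : probability (borel (rooted_space R)) R)
    mu.

Definition uniform_in (R : realType) d (T : measurableType d)
    (P : probability T R) (A : set permutation) (X : T -> nonempty_perm) :=
  (forall w, A (val (X w))) /\
  (forall s, A s ->
    P [set w | val (X w) = s] = ((#|` fset_set A|%:R)^-1)%:E).

(* Mutual independence of the sigma-algebras generated by a family of random
   variables is [independent P (fun i => generated (X i))]. *)
Definition generated d d' (T : measurableType d) (T' : measurableType d')
    (X : T -> T') : set (set T) := [set X @^-1` B | B in measurable].

Definition independent (R : realType) d (T : measurableType d)
    (P : probability T R) (I : choiceType) (F : I -> set (set T)) :=
  forall (J : {fset I}) (A : I -> set T), (forall i, i \in J -> F i (A i)) ->
    P (\bigcap_(i in [set` J]) A i) = (\prod_(i <- J) P (A i))%E.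

Section construction_inputs.
Context (R : realType) d (T : measurableType d) (P : probability T R).

Definition law_S (X : T -> permutation) :=
  [/\ forall w, Av231 (X w) \/ X w = empty_perm,
      forall s, Av231 s ->
        P [set w | X w = s] = (2^-1 * 4^-1 ^+ size s)%:E
    & P [set w | X w = empty_perm] = (2^-1)%:E].

Definition fair_coin (X : T -> bool) :=
  P [set w | X w = true] = (2^-1)%:E /\ P [set w | X w = false] = (2^-1)%:E.

(* Y has the conditional law of X given that X is non-empty. *)
Definition conditioned_nonempty (X : T -> permutation) (Y : T -> nonempty_perm) :=
  forall A : set permutation,
    P [set w | A (val (Y w))] =
    (fine (P [set w | A (X w) /\ X w <> empty_perm])
       / fine (P [set w | X w <> empty_perm]))%:E.

End construction_inputs.

(* r_h(u n) converges to r_h(y) for every h > 0; for each h there are finitely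
   many possible values of r_h, so that this means eventual equality. *)
Definition local_limit (u : nat -> rooted_perm) (y : rooted_perm) : Prop :=
  forall h, (0 < h)%N -> \forall n \near \oo, restr h (u n) = restr h y.

(* The order preceq_231 as a function of the realizations s0, s, x of the
   random inputs; the value outside of the almost sure event on which the limit
   exists is irrelevant. *)
Definition order231 (R : realType) (s0 : nonempty_perm)
    (s : nat -> permutation) (x : nat -> bool) : borel (rooted_space R) :=
  xget usual_order
    [set y | rp_dom y = setT /\
             local_limit (fun n => of_finite (glue_iter s0 s x n)) y].

Definition eq_in_distribution (R : realType) d1 d2 d' (T1 : measurableType d1)
    (T2 : measurableType d2) (T' : measurableType d') (P1 : probability T1 R)
    (P2 : probability T2 R) (X : T1 -> T') (Y : T2 -> T') :=
  [/\ measurable_fun setT X, measurable_fun setT Y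
    & forall B : set T', measurable B -> P1 (X @^-1` B) = P2 (Y @^-1` B)].

(* Main.v *)
(** Write C_n for the number of 231-avoiding permutations of size n. A rooted
    231-avoiding permutation is obtained in exactly one way from one rooted at
    its maximum by m successive gluings (its "spine" has length m), and the
    construction gives each z with a spine of length m the probability
    4^-|z| of being the m-th rooted permutation. On the other hand, among the
    n C_n rooted 231-avoiding permutations of size n, those obtained from z by
    further gluings number (n - |z| + 1) C_(n - |z|), and the Catalan
    recurrence (n + 2) C_(n+1) = (4 n + 2) C_n makes the proportion converge to
    4^-|z|. Once h entries are present on both sides of the root, gluings no
    longer change r_h; summing over finitely many such z shows that for every
    set U of windows, P(r_h in U) for the quenched limit is at least the same
    probability for the construction. Applied to U and to its complement this
    is an equality, and the events {r_h in U} form a pi-system generating the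
    Borel sets. *)

Require Import Defs.
From HB Require Import structures.
From mathcomp Require Import all_boot all_order all_algebra finmap.
From mathcomp Require Import all_classical all_reals all_analysis.
From mathcomp Require Import measurable_realfun zify ring lra.

Set Implicit Arguments.
Unset Strict Implicit.
Unset Printing Implicit Defensive.

Import Order.TTheory GRing.Theory Num.Theory.
Import numFieldNormedType.Exports.

Local Open Scope classical_set_scope.
Local Open Scope ring_scope.
Local Notation glue := Defs.glue.

(** * The maximum decomposition and Catalan numbers *)

(** [key] tells which block an element comes from, so distinct blocks are disjoint. Below, blocks
    are mostly indexed by size, and [key] is a size. *)
Lemma uniq_flatten_key (I T : eqType) (key : T -> I) (g : I -> seq T)
    (s : seq I) :
  uniq s -> {in s, forall i, uniq (g i)} ->
  {in s, forall i x, x \in g i -> key x = i} ->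
  uniq (flatten [seq g i | i <- s]).
Proof.
elim: s => //= i s IHs /andP[nis us] ug k.
rewrite cat_uniq ug ?mem_head// IHs//; first last.
- by move=> j js; apply: k; rewrite inE js orbT.
- by move=> j js; apply: ug; rewrite inE js orbT.
rewrite andbT; apply/hasPn => x /flatten_mapP[j js xj]; apply/negP => xi.
have := k i (mem_head _ _) x xi; rewrite (k j _ x xj) ?inE ?js ?orbT// => ji.
by rewrite -ji js in nis.
Qed.

Lemma perm_word_uniq (s : permutation) : uniq s.
Proof. by rewrite (perm_uniq (pwordP s)) iota_uniq. Qed.

Lemma mem_perm_word (s : permutation) x : (x \in pword s) = (0 < x <= size s)%N.
Proof. by rewrite (perm_mem (pwordP s)) mem_iota add1n ltnS. Qed.

Lemma nth_perm_word (s : permutation) i :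
  (i < size s)%N -> (0 < nth 0%N s i <= size s)%N.
Proof. by move=> is_; rewrite -mem_perm_word mem_nth. Qed.

Lemma permutation_eq (s t : permutation) : pword s = pword t -> s = t.
Proof. exact: val_inj. Qed.

Lemma size_join_max (s p : permutation) :
  size (join_max s p) = (size s + size p).+1.
Proof. by rewrite /= size_cat /= size_map addnS. Qed.

(** The entries of [s] are at most [size s], so the maximum is first met right after them. Its
    position tells where to cut the word, hence [join_max_inj]. *)
Lemma index_join_max (s p : permutation) :
  index (size (join_max s p)) (join_max s p) = size s.
Proof.
rewrite size_join_max /= index_cat mem_perm_word /= ltnNge leq_addr/=.
by rewrite addn1 [(size p + _)%N]addnC eqxx addn0.
Qed.

Lemma join_max_inj (s p s' p' : permutation) :
  join_max s p = join_max s' p' -> s = s' /\ p = p'.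
Proof.
move=> E; have ss' : size s = size s'.
  by rewrite -(index_join_max s p) E index_join_max.
move/(congr1 pword) : E => /= /eqP; rewrite eqseq_cat// => /andP[/eqP E1].
rewrite eqseq_cons => /andP[_ /eqP]; rewrite ss' => /inj_map E2.
by split; apply: permutation_eq => //; apply: E2 => ? ?; exact: addnI.
Qed.

Lemma finite_rooted_eq (x y : finite_rooted) :
  projT1 x = projT1 y -> projT2 x = projT2 y :> nat -> x = y.
Proof.
case: x => s i; case: y => t j /= st; subst t => ij.
by congr existT; apply: val_inj.
Qed.

Definition rsize (x : finite_rooted) : nat := size (projT1 x).

Lemma rsize_glue b y p : rsize (glue b y p) = (rsize y + size p).+1.
Proof.
by case: b y => -[s i]; rewrite /rsize [projT1 _]/= size_join_max // addnC.
Qed.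

(* The position of the root relative to the maximum of the permutation tells
   root_at_max, glueL and glueR apart. *)
Definition max_pos (x : finite_rooted) : nat :=
  index (rsize x) (pword (projT1 x)).

Lemma glue_max_pos b y p :
  if b then (projT2 (glue b y p) < max_pos (glue b y p))%N
  else (max_pos (glue b y p) < projT2 (glue b y p))%N.
Proof.
case: b y => -[s i]; rewrite /max_pos /rsize /glue /= -/(join_max _ _).
  by have /= -> := index_join_max s p.
by have /= -> := index_join_max p s; rewrite addn1 ltnS leq_addr.
Qed.

Lemma perm_maxE (s : permutation) : perm_max s = size s.
Proof.
rewrite /perm_max (perm_big _ (pwordP s)) /=.
apply/eqP; rewrite eqn_leq; apply/andP; split.
  by apply/bigmax_leqP_seq => i; rewrite mem_iota => /andP[_]; rewrite add1n.
case: (posnP (size s)) => [->//|s0].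
by apply: (@leq_bigmax_seq _ _ _ id) => //; rewrite mem_iota s0 add1n ltnS leqnn.
Qed.

Lemma root_at_max_pos (s : nonempty_perm) :
  projT2 (root_at_max s) = max_pos (root_at_max s) :> nat.
Proof. by rewrite /max_pos /rsize /= perm_maxE. Qed.

Lemma glue_neq_root_at_max b y p s : glue b y p <> root_at_max s.
Proof.
move=> E; have := glue_max_pos b y p.
by rewrite E root_at_max_pos ltnn; case: b {E}.
Qed.

(** The side [b] is read off from the position of the root relative to the maximum; cutting at the
    maximum then recovers [y] and [p]. *)
Lemma glue_inj b y p b' y' p' :
  glue b y p = glue b' y' p' -> [/\ b = b', y = y' & p = p'].
Proof.
move=> E; have bb' : b = b'.
  have := glue_max_pos b y p; have := glue_max_pos b' y' p'; rewrite E.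
  by case: (b) (b') => -[]// /ltnW h1; rewrite ltnNge h1.
subst b'; have E1 := congr1 (@projT1 _ _) E.
have E2 : projT2 (glue b y p) = projT2 (glue b y' p') :> nat by rewrite E.
move: E1 E2; clear E; case: b y y' => -[s i] [s' i'] /join_max_inj[? ?].
  by move=> /= ii'; split=> //; apply: finite_rooted_eq.
subst; rewrite /= => /addIn/addnI ii'.
by split=> //; apply: finite_rooted_eq.
Qed.

Lemma root_at_max_inj : injective root_at_max.
Proof. by move=> s t /(congr1 (@projT1 _ _)) /= /val_inj. Qed.

(** Entries left of the maximum are smaller than those right of it, so a pattern 231 can neither
    straddle the maximum nor use it: it lies within [s] or within [p]. *)
Lemma avoids231_join_max (s p : permutation) :
  avoids231 (join_max s p) <-> avoids231 s /\ avoids231 p.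
Proof.
have nl i : (i < size s)%N -> nth 0%N (join_max s p) i = nth 0%N s i.
  by move=> is_; rewrite /= nth_cat is_.
have nm : nth 0%N (join_max s p) (size s) = (size s + size p).+1.
  by rewrite /= nth_cat ltnn subnn /= addn1 addnC.
have nr i : (i < size p)%N ->
    nth 0%N (join_max s p) (size s + i.+1) = (size s + nth 0%N p i)%N.
  move=> ip; rewrite /= nth_cat ltnNge leq_addr/= addKn /=.
  by rewrite (nth_map 0%N).
rewrite /avoids231; split=> [H|[Hs Hp] a b c abc]; first split=> a b c abc cs.
- have := H a b c abc; rewrite size_join_max !nl; [apply|..]; lia.
- have := H (size s + a.+1)%N (size s + b.+1)%N (size s + c.+1)%N.
  rewrite size_join_max !nr ?ltn_add2l; [|lia..].
  by apply; [lia|lia].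
- rewrite size_join_max => cs.
  have vl i : (i < size s)%N -> (nth 0%N (join_max s p) i <= size s)%N.
    by move=> is_; rewrite nl//; have := nth_perm_word is_; lia.
  have vr i : (i < size p)%N -> (size s < nth 0%N (join_max s p) (size s + i.+1)
       < (size s + size p).+1)%N.
    by move=> ip; rewrite nr//; have := nth_perm_word ip; lia.
  have vr' i : (size s < i)%N -> (i < (size s + size p).+1)%N ->
      exists2 j, (j < size p)%N & i = (size s + j.+1)%N.
    by move=> ? ?; exists (i - (size s).+1)%N; lia.
  case: (ltngtP c (size s)) => cs'.
  + rewrite !nl; [|lia..]; apply: Hs; lia.
  + case: (ltngtP a (size s)) => as'.
    * have := vl _ as'; have [j jp ->] := vr' c cs' cs; have := vr j jp; lia.
    * have [j jp cE] := vr' c cs' cs; have [i ip aE] := vr' a as' ltac:(lia).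
      have [k kp bE] := vr' b ltac:(lia) ltac:(lia).
      subst; rewrite !nr// !ltn_add2l; apply: Hp; lia.
    * have [k kp bE] := vr' b ltac:(lia) ltac:(lia).
      by rewrite as' nm bE; have := vr k kp; lia.
  + have vv : (nth 0%N (join_max s p) a <= (size s + size p).+1)%N.
      by have := vl a ltac:(lia); lia.
    rewrite cs' nm; lia.
Qed.

Lemma join_max_surj (s : permutation) :
  pword s != [::] -> avoids231 s -> exists u v, s = join_max u v.
Proof.
move=> s0 av; set n := size s.
have n0 : (0 < n)%N by rewrite lt0n size_eq0.
have ns : n \in pword s by rewrite mem_perm_word n0 /=.
have [a [b sE]] : exists a b, pword s = a ++ n :: b.
  by case/splitPr: ns => a b; exists a, b.
have nE : n = (size a + size b).+1 by rewrite /n sE size_cat /= addnS.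
have pab : perm_eq (a ++ b) (iota 1 (size a + size b)).
  have := pwordP s; rewrite /is_perm_word -/n sE -cat1s perm_catCA /= nE.
  rewrite -addn1 iotaD perm_sym perm_catC perm_sym /= add1n.
  by rewrite addn1 perm_cons.
have us := perm_word_uniq s.
(* If [y < x], then [x], the maximum [n] and [y] form a pattern 231. *)
have ab x y : x \in a -> y \in b -> (x <= y)%N.
  move=> xa yb; rewrite leqNgt; apply/negP => yx.
  apply: (av (index x a) (size a) (size a + (index y b).+1)%N).
  - by rewrite index_mem xa /=; lia.
  - by rewrite sE size_cat /= ltn_add2l ltnS index_mem.
  - rewrite sE !nth_cat index_mem xa ltnn subnn /=.
    rewrite [(size a + _ < _)%N]ltnNge leq_addr /= addKn /=.
    rewrite !nth_index// yx /=.
    have := mem_perm_word s x; rewrite sE mem_cat xa /= -sE => /esym/andP[_].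
    rewrite -/n leq_eqVlt => /orP[/eqP xn|//].
    by move: us; rewrite sE cat_uniq /= -xn xa /= andbF.
(* Sorting [a] and [b] separately thus sorts the whole: [a] is a permutation word, and [b] is one
   shifted by [size a]. *)
have srt : sorted leq (sort leq a ++ sort leq b).
  rewrite sorted_pairwise; last exact: leq_trans.
  rewrite pairwise_cat -!(sorted_pairwise leq_trans) !sort_sorted ?andbT//;
    try exact: leq_total.
  by apply/allrelP => x y; rewrite !mem_sort; exact: ab.
have E : sort leq a ++ sort leq b = iota 1 (size a + size b).
  apply: (sorted_eq leq_trans anti_leq) => //; first exact: iota_sorted.
  by apply: perm_trans pab; apply: perm_cat; rewrite perm_sort.
move: E; rewrite iotaD => /eqP; rewrite eqseq_cat ?size_sort ?size_iota//.
move=> /andP[/eqP Ea /eqP Eb].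
have pa : is_perm_word a by rewrite /is_perm_word -Ea perm_sym perm_sort.
have pb : perm_eq b (iota (1 + size a) (size b)).
  by rewrite -Eb perm_sym perm_sort.
have pc : is_perm_word [seq (x - size a)%N | x <- b].
  rewrite /is_perm_word size_map.
  rewrite (_ : iota 1 _ = [seq (x - size a)%N | x <- iota (1 + size a) (size b)]).
    exact: perm_map.
  rewrite addnC iotaDl -map_comp -[LHS]map_id; apply: eq_map => x /=.
  by rewrite addKn.
exists (Permutation pa), (Permutation pc); apply: permutation_eq.
rewrite /= sE size_map addn1 [in (size b + _)%N]addnC -nE -map_comp.
congr (_ ++ _ :: _); rewrite -[LHS]map_id; apply/eq_in_map => x xb /=.
by rewrite subnKC//; move: xb; rewrite (perm_mem pb) mem_iota; lia.
Qed.

Definition avs (n : nat) : {fset permutation} := fset_set (Av231n n).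

Lemma mem_avs n s : (s \in avs n) <-> size s = n /\ avoids231 s.
Proof. by rewrite in_fset_set; [rewrite inE|exact: finite_Av231n]. Qed.

Lemma card_avs0 : #|` avs 0| = 1%N.
Proof.
rewrite (_ : avs 0 = [fset empty_perm]%fset) ?cardfs1//.
apply/fsetP => s; rewrite !inE; apply/idP/eqP => [/mem_avs[/size0nil s0 _]|->].
  exact: permutation_eq.
by apply/mem_avs; split=> // a b c _.
Qed.

(** The Catalan recurrence: cutting at the maximum is a bijection onto the pairs of 231-avoiding
    permutations of total size [n]. *)
Lemma card_avsS n :
  #|` avs n.+1| = (\sum_(i < n.+1) #|` avs i| * #|` avs (n - i)|)%N.
Proof.
pose g i := [seq (s, p) | s <- avs i, p <- avs (n - i)].
pose L := flatten [seq g i | i <- iota 0 n.+1].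
have memL s p : ((s, p) \in L) <->
    [/\ avoids231 s, avoids231 p & (size s + size p = n)%N].
  split=> [/flatten_mapP[i ii /allpairsP[[s' p'] /= [ms mp [-> ->]]]]|].
    move/mem_avs : ms => [si avs_]; move/mem_avs : mp => [pi avp].
    by split=> //; move: ii; rewrite mem_iota si pi; lia.
  move=> [avs_ avp spn]; apply/flatten_mapP; exists (size s).
    by rewrite mem_iota; lia.
  apply/allpairsP; exists (s, p); split=> //; apply/mem_avs => //=.
  by split=> //; lia.
have uL : uniq L.
  apply: (@uniq_flatten_key _ _ (fun x => size (pword x.1))); first exact: iota_uniq.
    by move=> i _; apply: allpairs_uniq; rewrite ?fset_uniq// => -[? ?] [? ?].
  by move=> i _ x /allpairsP[[s' p'] /= [/mem_avs[? _] _ ->]].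
transitivity (size [seq join_max x.1 x.2 | x <- L]).
  apply: perm_size; apply: uniq_perm; first exact: fset_uniq.
    by rewrite map_inj_uniq// => -[s p] [s' p'] /= /join_max_inj[-> ->].
  move=> s; apply/idP/mapP => [/mem_avs[sn av]|[[u v] uvL ->]].
    have [|u [v sE]] := @join_max_surj s _ av; first by rewrite -size_eq0 sn.
    exists (u, v) => //; apply/memL.
    move: sn av; rewrite sE => sn /avoids231_join_max[? ?]; split=> //.
    by move: sn; rewrite size_join_max => -[].
  apply/mem_avs; move/memL : uvL => [? ? uvn].
  by split; [rewrite size_join_max uvn|apply/avoids231_join_max].
rewrite size_map size_flatten /shape -map_comp sumnE big_map.
rewrite -/(index_iota 0 n.+1) big_mkord.
by apply: eq_bigr => i _ /=; rewrite size_allpairs.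
Qed.

Section catalan_recurrence.
Variable c : nat -> nat.
Hypothesis c0 : c 0%N = 1%N.
Hypothesis cS : forall n, c n.+1 = (\sum_(i < n.+1) c i * c (n - i))%N.

(* Pairing i with n - i. *)
Lemma catalan_weighted_sum n :
  (2 * (\sum_(i < n.+1) i.+1 * c i * c (n - i)) = n.+2 * c n.+1)%N.
Proof.
rewrite mul2n -addnn {2}(reindex_inj rev_ord_inj) /= -big_split /= cS big_distrr.
apply: eq_bigr => i _ /=; rewrite subSS subKn; last by rewrite -ltnS.
rewrite -!mulnA [(c (n - i) * c i)%N]mulnC -mulnDl; congr (_ * _)%N.
by have := ltn_ord i; lia.
Qed.

(** In the weighted sum for [n + 1], the induction hypothesis turns the term of index [i + 1] into
    [4 * (i.+1 * c i * c (n - i)) - 2 * (c i * c (n - i))]. Summing gives back the weighted sum for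
    [n] and the recurrence for [c n.+1]. *)
Lemma catalan_ratio n : (n.+2 * c n.+1 = (4 * n + 2) * c n)%N.
Proof.
elim/ltn_ind: n => -[_|n IH].
  by rewrite cS big_ord_recl big_ord0 subn0 c0.
rewrite -catalan_weighted_sum big_ord_recl /= subn0 c0.
under eq_bigr => i _.
  rewrite /bump /= add1n (IH i)//.
  rewrite (_ : _ * _ * _ = 4 * (i.+1 * c i * c (n - i)) - 2 * (c i * c (n - i)))%N.
    over.
  by rewrite subSS; nia.
(* Subtraction on [nat] is truncated, so splitting the sum of differences needs this inequality. *)
have le2 : (\sum_(i < n.+1) 2 * (c i * c (n - i)) <=
    \sum_(i < n.+1) 4 * (i.+1 * c i * c (n - i)))%N.
  by apply: leq_sum => i _; nia.
rewrite (_ : \sum_(i < n.+1) (_ - _) = \sum_(i < n.+1) 4 * (i.+1 * c i * c (n - i))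
   - \sum_(i < n.+1) 2 * (c i * c (n - i)))%N; last first.
  apply/eqP; rewrite -(eqn_add2r (\sum_(i < n.+1) 2 * (c i * c (n - i)))).
  rewrite subnK// -big_split; apply/eqP/eq_bigr => i _ /=.
  by rewrite subnK//; nia.
rewrite -!big_distrr /= -cS.
have := catalan_weighted_sum n; move: (\sum_(i < _) _)%N => T H.
by nia.
Qed.

End catalan_recurrence.

(** * Gluings, spines and windows *)

Definition rooted_avs (n : nat) : seq finite_rooted :=
  flatten [seq [seq rooted_at i | i <- enum 'I_(size s)] | s : permutation <- avs n].

Lemma mem_rooted_avs n x :
  (x \in rooted_avs n) <-> rsize x = n /\ avoids231 (projT1 x).
Proof.
split=> [/flatten_mapP[s /mem_avs[sn av] /mapP[i _ ->]]//|[xn av]].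
apply/flatten_mapP; exists (projT1 x); first exact/mem_avs.
by apply/mapP; exists (projT2 x); [rewrite mem_enum|case: x {xn av}].
Qed.

Lemma rooted_avs_uniq n : uniq (rooted_avs n).
Proof.
apply: (@uniq_flatten_key _ _ (@projT1 _ _)); first exact: fset_uniq.
  move=> s _; rewrite map_inj_uniq ?enum_uniq// => i j.
  move=> /(congr1 (fun x => nat_of_ord (projT2 x))).
  exact: val_inj.
by move=> s _ x /mapP[i _ ->].
Qed.

(** The number of ways to add [j] entries to a rooted permutation by successive gluings of
    231-avoiding permutations. [contextsS] decomposes along the last gluing: two sides, and a glued
    permutation of size [n - j]. *)
Definition contexts (j : nat) : nat := (j.+1 * #|` avs j|)%N.

Lemma contexts0 : contexts 0 = 1%N.
Proof. by rewrite /contexts card_avs0. Qed.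

Lemma contextsS n :
  contexts n.+1 = (\sum_(j < n.+1) 2 * (contexts j * #|` avs (n - j)|))%N.
Proof.
rewrite -big_distrr /=.
exact/esym/(@catalan_weighted_sum (fun k => #|` avs k|) card_avs0 card_avsS).
Qed.

(** [contextsS] for gluings that start from size [r], reindexed by the total size [j] reached before
    the last one. *)
Lemma contexts_shift r n : (r < n)%N ->
  contexts (n - r) =
  (\sum_(j < n | (r <= j)%N) 2 * (contexts (j - r) * #|` avs (n - j.+1)|))%N.
Proof.
move=> rn; rewrite -(subnSK rn) contextsS.
rewrite -(big_mkord (fun j => r <= j)%N
  (fun j => 2 * (contexts (j - r) * #|` avs (n - j.+1)|)))%N.
rewrite (big_cat_nat _ (ltnW rn))//= [X in _ = (X + _)%N]big_nat_cond.
rewrite [X in _ = (X + _)%N]big1 ?add0n; last first.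
  by move=> i; lia.
rewrite [RHS](_ : _ = \sum_(0 + r <= i < n | (r <= i)%N)
  2 * (contexts (i - r) * #|` avs (n - i.+1)|))%N//.
rewrite big_addn [RHS]big_nat_cond (subnSK rn).
rewrite (eq_bigl (fun i => (0 <= i < n - r)%N)) => [|i]; last first.
  by rewrite leq_addl andbT.
rewrite -big_nat big_mkord; apply: eq_bigr => i _.
by rewrite addnK; congr (_ * (_ * #|` avs _|))%N; lia.
Qed.

(* As no gluing lands in F, a rooted permutation arises from at most one pair
   made of a context and a member of F. *)
Lemma count_descendants (F : seq finite_rooted) (Q : pred finite_rooted) :
  uniq F -> {in F, forall x, Q x /\ avoids231 (projT1 x)} ->
  (forall b y p, Q y -> Q (glue b y p)) ->
  (forall b y p, Q y -> glue b y p \notin F) ->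
  forall n, (\sum_(x <- F | (rsize x <= n)%N) contexts (n - rsize x) <=
    count Q (rooted_avs n))%N.
Proof.
move=> uF FQ Qglue Fglue; elim/ltn_ind => n IH.
(* Among the elements of [Q] of size [n] are the members of [F] of that size ([D]) and the gluings
   of smaller elements of [Q] ([GL] below). Gluings avoid [F] and [glue] is injective, so nothing is
   counted twice. *)
pose D := [seq x <- F | rsize x == n].
pose g j := [seq (b, yp) | b <- [:: true; false],
  yp <- [seq (y, p) | y <- [seq y <- rooted_avs j | Q y], p <- avs (n - j.+1)]].
pose L := flatten [seq g j | j <- iota 0 n].
have gP j b y p : (b, (y, p)) \in g j ->
    [/\ rsize y = j, avoids231 (projT1 y), Q y, size p = (n - j.+1)%N &
        avoids231 p].
  move=> /allpairsP[[b' yp] /= [_ /allpairsP[[y' p'] /= [yj pj ->] [_ -> ->]]]].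
  move: yj; rewrite mem_filter => /andP[-> /mem_rooted_avs[-> ?]].
  by move/mem_avs : pj => [-> ?].
have uL : uniq L.
  apply: (@uniq_flatten_key _ _ (fun u => rsize u.2.1)); first exact: iota_uniq.
    move=> j _; apply: allpairs_uniq => //; last by move=> [? ?] [? ?].
    apply: allpairs_uniq; last by move=> [? ?] [? ?].
    - by rewrite filter_uniq ?rooted_avs_uniq.
    - exact: fset_uniq.
  by move=> j _ [b [y p]] /gP[].
pose GL := [seq glue u.1 u.2.1 u.2.2 | u <- L].
have uDGL : uniq (D ++ GL).
  rewrite cat_uniq filter_uniq//= map_inj_uniq ?uL ?andbT; last first.
    by move=> [b [y p]] [b' [y' p']] /= /glue_inj[-> -> ->].
  apply/hasPn => _ /mapP[[b [y p]] /flatten_mapP[j _ /gP[_ _ Qy _ _]] ->] /=.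
  by rewrite mem_filter (negbTE (Fglue _ _ _ Qy)) andbF.
have sub : {subset D ++ GL <= [seq x <- rooted_avs n | Q x]}.
  move=> x; rewrite mem_cat mem_filter => /orP[].
    rewrite mem_filter => /andP[/eqP xn /FQ[-> ?]] /=.
    exact/mem_rooted_avs.
  move=> /mapP[[b [y p]] /flatten_mapP[j jn /gP[yj yav Qy pj pav]] ->] /=.
  rewrite mem_filter Qglue//=; apply/mem_rooted_avs; rewrite rsize_glue; split.
    by rewrite mem_iota in jn; lia.
  by case: b y yav {yj Qy} => -[s i] /= ?; apply/avoids231_join_max.
have := uniq_leq_size uDGL sub; rewrite size_filter; apply: leq_trans.
rewrite size_cat size_map.
rewrite (bigID (fun x => rsize x == n)) /=; apply: leq_add.
  rewrite size_filter -sum1_count.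
  rewrite (eq_bigl (fun x => rsize x == n)) => [|x]; last by lia.
  by apply: leq_sum => x /eqP ->; rewrite subnn contexts0.
rewrite size_flatten /shape -map_comp sumnE big_map.
rewrite -[n in iota 0 n]subn0 -/(index_iota 0 n) big_mkord.
(* The induction hypothesis bounds the number of elements of [Q] of each size [j]; once the sums are
   exchanged, [contexts_shift] evaluates the inner one. *)
apply: (@leq_trans (\sum_(j < n) \sum_(x <- F | (rsize x <= j)%N)
    2 * (contexts (j - rsize x) * #|` avs (n - j.+1)|))); last first.
  apply: leq_sum => j _ /=; rewrite !size_allpairs /= size_filter.
  by rewrite -big_distrr -big_distrl /= leq_mul2l leq_mul2r IH ?orbT.
rewrite (exchange_big_dep predT)//= [leqRHS](bigID (fun x => rsize x < n)%N) /=.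
apply: leq_trans (leq_addr _ _).
rewrite (eq_bigl (fun x => (rsize x < n)%N)) => [|x]; last by lia.
by apply: leq_sum => x xn; rewrite contexts_shift.
Qed.

Fixpoint spine (m : nat) : set finite_rooted :=
  if m is k.+1 then [set x | exists b y p, spine k y /\ x = glue b y p]
  else range root_at_max.

Lemma spine_inj m m' x : spine m x -> spine m' x -> m = m'.
Proof.
elim: m m' x => [|m IHm] [|m'] x //=.
- by move=> [s _ <-] [b [y [p [_ /esym/glue_neq_root_at_max]]]].
- by move=> [b [y [p [_ ->]]]] [s _ /esym/glue_neq_root_at_max].
- move=> [b [y [p [ym ->]]]] [b' [y' [p' [ym' /glue_inj[_ yy' _]]]]].
  by congr _.+1; apply: IHm ym _; rewrite yy'.
Qed.

Lemma spine_glue_iter s0 s x m : spine m (glue_iter s0 s x m).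
Proof.
elim: m => [|m IHm]; first by exists s0.
by exists (x m), (glue_iter s0 s x m), (s m.+1).
Qed.

Definition window (h : nat) (x : finite_rooted) : bool :=
  (h <= projT2 x)%N && (projT2 x + h < rsize x)%N.

Definition rdom (x : finite_rooted) : set int := of_finite_dom (projT2 x).
Definition rle (x : finite_rooted) : int -> int -> Prop := of_finite_le (projT2 x).

Lemma rdomE x z :
  rdom x z <-> - (projT2 x)%:Z <= z /\ z < (rsize x)%:Z - (projT2 x)%:Z.
Proof. by split=> [/andP[]|[? ?]] //; apply/andP. Qed.

Lemma glue_root b y p :
  projT2 (glue b y p) = (projT2 y + (if b then 0 else (size p).+1))%N :> nat.
Proof. by case: b y => -[s i] /=; lia. Qed.

Lemma windowP h x :
  window h x <-> forall z : int, - h%:Z <= z <= h%:Z -> rdom x z.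
Proof.
split=> [|H]; first by rewrite /window => ? z ?; apply/rdomE; lia.
by have /rdomE := H h%:Z ltac:(lia); have /rdomE := H (- h%:Z) ltac:(lia);
  rewrite /window; lia.
Qed.

Lemma rdom_glue b y p z : rdom y z -> rdom (glue b y p) z.
Proof.
move=> /rdomE yz; apply/rdomE; rewrite glue_root rsize_glue.
by case: b; lia.
Qed.

Lemma window_glue h b y p : window h y -> window h (glue b y p).
Proof. by move=> /windowP H; apply/windowP => z /H; exact: rdom_glue. Qed.

(** Positions are relative to the root, which moves along with the old entries. Gluing therefore
    only adds a constant to their values, and their order is kept. *)
Lemma rval_glue b y p z : rdom y z ->
  of_finite_val (projT2 (glue b y p)) z =
  ((if b then 0 else size p) + of_finite_val (projT2 y) z)%N.
Proof.
move=> /rdomE [z0 zs]; rewrite /of_finite_val glue_root.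
have [k kE ks] : exists2 k : nat, z + (projT2 y)%:Z = k & (k < rsize y)%N.
  by exists (absz (z + (projT2 y)%:Z)); lia.
rewrite kE; case: b => /=.
  rewrite addn0 kE; case: y ks {z0 zs kE} => s i /= ks.
  by rewrite nth_cat; rewrite /rsize /= in ks; rewrite ks.
rewrite (_ : absz _ = (size p).+1 + k)%N; last by lia.
case: y ks {z0 zs kE} => s i; rewrite /rsize /= => ks.
rewrite nth_cat ltnNge addSnnS leq_addr/= addKn /= (nth_map 0%N)//.
Qed.

Lemma rle_glue b y p u v : rdom y u -> rdom y v ->
  rle (glue b y p) u v <-> rle y u v.
Proof.
move=> yu yv; rewrite /rle /of_finite_le !rval_glue// leq_add2l.
by split=> -[_ _ ?]; split=> //; exact: rdom_glue.
Qed.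

Lemma restr_window_eq h x (y : rooted_perm) : window h x ->
  (forall z : int, - h%:Z <= z <= h%:Z -> rp_dom y z) ->
  (forall u v, rdom x u -> rdom x v -> rle x u v <-> rp_le y u v) ->
  restr h (of_finite x) = restr h y.
Proof.
move=> /windowP xh yh le; have dom : restr_dom h (of_finite x) = restr_dom h y.
  apply/funext => z; apply/propext; split=> -[_ zh]; split=> //.
    exact: yh.
  exact: xh.
apply: rooted_perm_eq => //=; apply/funext => u; apply/funext => v.
apply/propext; rewrite /restr_le dom; split=> -[hu hv uv]; split=> //.
  by apply/le => //; apply: xh; [case: hu|case: hv].
by apply/le => //; apply: xh; [case: hu|case: hv].
Qed.

Lemma restr_glue h b y p : window h y ->
  restr h (of_finite (glue b y p)) = restr h (of_finite y).
Proof.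
move=> hy; apply/esym/restr_window_eq => // [|u v yu yv].
  exact/windowP/window_glue.
exact: iff_sym (rle_glue b p yu yv).
Qed.

(** * Asymptotic density of descendants *)

Lemma catalan_avs n : (n.+2 * #|` avs n.+1| = (4 * n + 2) * #|` avs n|)%N.
Proof. exact: (@catalan_ratio (fun k => #|` avs k|) card_avs0 card_avsS). Qed.

Lemma card_avs_gt0 n : (0 < #|` avs n|)%N.
Proof. by elim: n => [|n IHn]; [rewrite card_avs0|have := catalan_avs n; nia]. Qed.

Lemma contexts_gt0 n : (0 < contexts n)%N.
Proof. by rewrite muln_gt0 card_avs_gt0. Qed.

Section asymptotics.
Variable R : realType.

(** By [catalan_avs], the inverse ratio is [(4 * n + 2) / (n + 1)], that is, 4 minus twice the
    inverse of [n + 1]. *)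
Lemma cvg_contexts_ratioS :
  (fun n => (contexts n)%:R / (contexts n.+1)%:R : R) @ \oo --> (4^-1 : R).
Proof.
rewrite (_ : (fun _ => _) = (fun n => (4 - 2 * (n.+1%:R)^-1)^-1)); last first.
  apply/funext => n; rewrite -[LHS]invrK invf_div; congr (_^-1).
  have c0 : (#|` avs n|)%:R != 0 :> R by rewrite pnatr_eq0 -lt0n card_avs_gt0.
  rewrite /contexts catalan_avs !natrM natrD natrM.
  by field; rewrite c0 nat1r pnatr_eq0.
have -> : 4^-1 = (4 - 2 * 0)^-1 :> R by rewrite mulr0 subr0.
apply: cvgV; first by rewrite mulr0 subr0 pnatr_eq0.
apply: cvgB; first exact: cvg_cst.
apply: cvgM; first exact: cvg_cst.
exact: cvg_harmonic.
Qed.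

Lemma cvg_contexts_ratio k :
  (fun n => (contexts n)%:R / (contexts (n + k))%:R : R) @ \oo --> (4^-1 ^+ k : R).
Proof.
elim: k => [|k IHk].
  rewrite (_ : (fun _ => _) = cst 1); first by rewrite expr0; exact: cvg_cst.
  by apply/funext => n; rewrite addn0 mulfV// pnatr_eq0 -lt0n contexts_gt0.
rewrite (_ : (fun _ => _) = (fun n => (contexts n)%:R / (contexts (n + k))%:R *
    ((contexts (n + k))%:R / (contexts (n + k).+1)%:R))).
  rewrite exprSr; apply: cvgM => //.
  have := cvg_contexts_ratioS.
  by rewrite -(cvg_shiftn k (fun n => (contexts n)%:R / (contexts n.+1)%:R : R)).
apply/funext => n; rewrite addnS mulrA divfK// pnatr_eq0 -lt0n.
exact: contexts_gt0.
Qed.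

Lemma cvg_contexts_rooted k :
  (fun n => if (k <= n)%N then
     (contexts (n - k))%:R / (n * #|` avs n|)%:R : R else 0) @ \oo -->
  (4^-1 ^+ k : R).
Proof.
have cvg1 : (fun n => (contexts n)%:R / (contexts (n + k))%:R *
   (1 - (n + k).+1%:R^-1)^-1) @ \oo --> (4^-1 ^+ k * (1 - 0)^-1 : R).
  apply: cvgM; first exact: cvg_contexts_ratio.
  apply: cvgV; first by rewrite subr0 oner_eq0.
  apply: cvgB; first exact: cvg_cst.
  by have := @cvg_harmonic R; rewrite -(cvg_shiftn k); exact.
move: cvg1; rewrite subr0 invr1 mulr1 -[X in _ -> X](cvg_shiftn k).
rewrite [X in X @ _ --> _ -> _](_ : _ = (fun n => if (k <= n + k)%N then
     (contexts (n + k - k))%:R / ((n + k) * #|` avs (n + k)|)%:R : R else 0))//.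
apply/funext => n; rewrite leq_addl addnK.
(* At size 0 both sides vanish, since the inverse of 0 is 0. *)
case: (n + k)%N => [|N]; first by rewrite mul0n invr1 subrr invr0 !mulr0.
have c0 : (#|` avs N.+1|)%:R != 0 :> R by rewrite pnatr_eq0 -lt0n card_avs_gt0.
rewrite [contexts N.+1]/contexts !natrM.
by field; rewrite c0 /= nat1r -natrD !pnatr_eq0.
Qed.

(** [count_descendants] is divided by the total number of rooted permutations. As [F] is finite, the
    limit can be taken term by term. *)
Lemma descendants_density (F : seq finite_rooted) (Q V : pred finite_rooted) (p : R) :
  uniq F -> {in F, forall x, Q x /\ avoids231 (projT1 x)} ->
  (forall b y p, Q y -> Q (glue b y p)) ->
  (forall b y p, Q y -> glue b y p \notin F) ->
  subpred Q V ->
  (fun n => (count V (rooted_avs n))%:R / (n * #|` avs n|)%:R : R) @ \oo --> p ->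
  \sum_(x <- F) 4^-1 ^+ rsize x <= p :> R.
Proof.
move=> uF FQ Qg Fg QV Vp.
pose f x n : R := if (rsize x <= n)%N then
   (contexts (n - rsize x))%:R / (n * #|` avs n|)%:R else 0.
have fcvg : (fun n => \sum_(x <- F) f x n) @ \oo -->
    (\sum_(x <- F) 4^-1 ^+ rsize x : R).
  elim: (F) => [|x s IHs].
    by under eq_fun do rewrite big_nil; rewrite big_nil; exact: cvg_cst.
  under eq_fun do rewrite big_cons; rewrite big_cons.
  by apply: cvgD => //; exact: cvg_contexts_rooted.
apply: ler_cvg_to fcvg Vp _; apply: nearW => n.
rewrite -big_mkcond -big_distrl /= ler_wpM2r ?invr_ge0//.
rewrite -natr_sum ler_nat; apply: leq_trans (sub_count QV _).
exact: count_descendants.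
Qed.

End asymptotics.

(** * Cylinders of the local topology *)

Lemma exists_half_expn_lt (R : realType) (e : R) : 0 < e ->
  exists k : nat, 2^-1 ^+ k.+1 < e.
Proof.
move=> e0; exists (Num.truncn e^-1).
rewrite exprVn invf_plt ?posrE ?exprn_gt0//.
apply: lt_le_trans (truncnS_gt _) _.
by rewrite -natrX ler_nat; exact/ltnW/ltn_expl.
Qed.

Section cylinders.
Variable R : realType.
Implicit Types (U : set rooted_perm) (y z : rooted_space R).

Definition cylinder h U : set (borel (rooted_space R)) :=
  [set y : rooted_perm | U (restr h y)].

Lemma ball_restr h y z : ball y (2 `^ (- h%:R) : R) z -> restr h y = restr h z.
Proof.
rewrite ballEmdist /= -[mdist y z]/(local_dist y z : R).
case: (@local_dist_cases R y z) => [[-> _//]|[k kP ->] kh].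
have hk : (h < k)%N.
  rewrite ltnNge; apply/negP => kh'; move: kh; apply/negP; rewrite -leNgt.
  by rewrite ler_powR ?ler1n// lerN2 ler_nat.
by apply: (restr_le_agree (ltnW hk)); apply/kP => //; exact: leq_ltn_trans hk.
Qed.

Lemma restr_ball h y z (e : R) : (0 < h)%N -> 2 `^ (- h%:R) < e ->
  restr h y = restr h z -> ball y e z.
Proof.
move=> h0 he yz; rewrite ballEmdist /= -[mdist y z]/(local_dist y z : R).
apply: le_lt_trans he.
case: (@local_dist_cases R y z) => [[_ ->]|[k kP ->]]; first exact: powR_ge0.
by rewrite ler_powR ?ler1n// lerN2 ler_nat; apply/kP.
Qed.

Lemma open_cylinder h U : open (cylinder h U : set (rooted_space R)).
Proof.
rewrite openE => y Uy; apply/nbhs_ballP; exists (2 `^ (- h%:R)) => /=.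
  exact: powR_gt0.
by move=> z /ball_restr E; rewrite /cylinder /= -E.
Qed.

(** Around each of its points, an open set contains a ball, hence a cylinder. Since [U] is arbitrary
    in [cylinder h U], all those of the same [h] merge into one, which leaves a countable union. *)
Lemma open_bigcup_cylinder (O : set (rooted_space R)) : open O ->
  O = \bigcup_h cylinder h [set x | forall z : rooted_perm, restr h z = x -> O z].
Proof.
move=> oO; apply/seteqP; split=> [y Oy|y [h _] /= /(_ y erefl)//].
move: oO; rewrite openE => /(_ y Oy) /nbhs_ballP[e /= e0 yeO].
have [k] := exists_half_expn_lt e0.
rewrite exprVn -powR_mulrn// -powRN => ke.
by exists k.+1 => //= z zy; apply: yeO; apply: (@restr_ball k.+1).
Qed.

Definition cylinders : set (set (borel (rooted_space R))) :=
  [set A | exists h U, A = cylinder h U].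

Lemma borel_cylinders : measurable = <<s cylinders >>.
Proof.
apply/seteqP; split.
  apply: smallest_sub; first exact: smallest_sigma_algebra.
  move=> O /open_bigcup_cylinder ->; apply: sigma_algebra_bigcup => h.
  by apply: sub_sigma_algebra; eexists; eexists.
apply: smallest_sub; first exact: smallest_sigma_algebra.
by move=> _ [h [U ->]]; apply: sub_sigma_algebra; exact: open_cylinder.
Qed.

Lemma measurable_cylinder h U : measurable (cylinder h U).
Proof. by rewrite borel_cylinders; apply: sub_sigma_algebra; exists h, U. Qed.

Lemma restr_restr h h' (y : rooted_perm) : (h <= h')%N ->
  restr h (restr h' y) = restr h y.
Proof.
move=> hh'; have sub (z : int) : - h%:Z <= z <= h%:Z -> - h'%:Z <= z <= h'%:Z by lia.
apply: rooted_perm_eq.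
  apply/seteqP; split=> z /=; first by move=> [[]].
  by move=> [yz hz]; split=> //; split=> //; exact: sub.
apply/funext => u; apply/funext => v; apply/propext; split.
  by move=> [[[yu _] hu] [[yv _] hv] [_ _ uv]].
move=> [[yu hu] [yv hv] uv].
by do 3?[split] => //; exact: sub.
Qed.

Lemma cylinder_le h h' U : (h <= h')%N ->
  cylinder h U = cylinder h' [set x | U (restr h x)].
Proof.
by move=> hh'; apply/funext => y; rewrite /cylinder /= restr_restr.
Qed.

Lemma setI_closed_cylinders : setI_closed cylinders.
Proof.
move=> _ _ [h [U ->]] [k [V ->]].
rewrite (cylinder_le U (leq_maxl h k)) (cylinder_le V (leq_maxr h k)).
exists (maxn h k), [set x | U (restr h x) /\ V (restr k x)].
by [].
Qed.

Lemma continuous_cylinder h U :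
  continuous (\1_(cylinder h U) : rooted_space R -> R).
Proof.
move=> y; have : nbhs y [set z | \1_(cylinder h U) z = \1_(cylinder h U) y :> R].
  apply/nbhs_ballP; exists (2 `^ (- h%:R)) => /= [|z /ball_restr E].
    exact: powR_gt0.
  rewrite !indicE; congr (_%:R); congr nat_of_bool.
  by apply/idP/idP; rewrite !inE /cylinder /= E.
exact: (@cvg_near_cst _ _ _ _ (nbhs y) (nbhs_filter y)).
Qed.

Lemma bounded_continuous_cylinder h U :
  bounded_continuous (\1_(cylinder h U) : rooted_space R -> R).
Proof.
split; first exact: continuous_cylinder.
exists 1 => y; rewrite indicE ger0_norm ?ler0n//.
by rewrite lern1 leq_b1.
Qed.

Definition cylinder_prob h U (nu : weak_prob (rooted_space R) R) : R :=
  fine ((nu : probability (borel (rooted_space R)) R) (cylinder h U)).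

(** The mass of a cylinder is the integral of its indicator, a bounded continuous function, so it is
    one of the coordinates that define the weak topology. It can thus serve as a test function in
    [quenched_BS_cvg]. *)
Lemma bounded_continuous_cylinder_prob h U :
  bounded_continuous (@cylinder_prob h U).
Proof.
pose f : {f : rooted_space R -> R | bounded_continuous f} :=
  exist _ _ (bounded_continuous_cylinder h U).
have E : cylinder_prob h U = fun nu => @integrals (rooted_space R) R nu f.
  apply/funext => nu; rewrite /integrals /Rintegral /= integral_indic//.
    by rewrite setIT.
  exact: measurable_cylinder.
split; last first.
  exists 1 => nu; rewrite ger0_norm ?fine_ge0//.
  rewrite -lee_fin fineK ?fin_num_measure//; last exact: measurable_cylinder.
  by apply: probability_le1; exact: measurable_cylinder.
rewrite E => nu.
pose I : weak_prob (rooted_space R) R ->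
  {ptws {f : rooted_space R -> R | bounded_continuous f} -> R^o} := @integrals _ _.
apply: (@continuous_comp _ _ _ I (fun g => g f)).
  exact: initial_continuous.
exact: (@proj_continuous {classic {f : rooted_space R -> R | bounded_continuous f}}
  (fun=> R^o) f (I nu)).
Qed.

Lemma rooting_law_cylinder (s : nonempty_perm) h U :
  fine (rooting_law R s (cylinder h U)) =
  #|[pred i : 'I_(size (val s)) | `[< U (restr h (of_finite (rooted_at i))) >]]|%:R
    / (size (val s))%:R.
Proof.
rewrite /rooting_law.
under eq_bigr => i _ do rewrite diracE.
rewrite sumEFin -EFinM /= mulrC; congr (_ / _).
rewrite -natr_sum -sum1_card; congr (_%:R); rewrite [RHS]big_mkcond /=.
apply: eq_bigr => i _; rewrite inE.
by case: asboolP => H; [rewrite mem_set|rewrite memNset].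
Qed.

End cylinders.

(** * The annealed local limit *)

Lemma measurable_mfun_preimage d d' (T : measurableType d) (T' : measurableType d')
  (f : {mfun T >-> T'}) (A : set T') : measurable A -> measurable (f @^-1` A).
Proof. by move=> mA; rewrite -[X in measurable X]setTI; exact: measurable_funPT. Qed.

Definition in_cylinder h (U : set rooted_perm) : pred finite_rooted :=
  fun x => `[< U (restr h (of_finite x)) >].

Lemma count_rooted_avs (V : pred finite_rooted) n :
  count V (rooted_avs n) =
  (\sum_(s <- avs n) #|[pred i : 'I_(size (pword s)) | V (rooted_at i)]|)%N.
Proof.
rewrite count_flatten sumnE -map_comp big_map; apply: eq_bigr => s _ /=.
rewrite count_map -size_filter cardE /enum_mem -filter_predI.
by congr size; apply: eq_filter => i; rewrite /= !inE andbT.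
Qed.

Section annealed.
Variable R : realType.

(** Choosing [X w] uniformly and then a uniform root amounts to choosing uniformly among the rooted
    231-avoiding permutations of size [n]. *)
Lemma integral_rooting_law d (T : measurableType d) (P : probability T R)
    (X : {RV P >-> nonempty_perm}) n h U :
  (0 < n)%N -> uniform_in P (Av231n n) X ->
  \int[P]_w cylinder_prob h U
    (rooting_law R (X w) : probability (borel (rooted_space R)) R) =
  (count (in_cylinder h U) (rooted_avs n))%:R / (n * #|` avs n|)%:R.
Proof.
move=> n0 [XA Xunif].
pose g (s : permutation) : R :=
  #|[pred i : 'I_(size (pword s)) | in_cylinder h U (rooted_at i)]|%:R
  / (size (pword s))%:R.
have mX s : measurable [set w | val (X w) = s].
  exact: (@measurable_mfun_preimage _ _ _ _ X [set t | val t = s]).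
(* As [X] takes values in the finite set [avs n], the integrand is a finite combination of
   indicators. *)
have gE w : (cylinder_prob h U
    (rooting_law R (X w) : probability (borel (rooted_space R)) R))%:E =
  (\sum_(s <- avs n) (g s * \1_[set w | val (X w) = s] w)%:E)%E.
  rewrite /cylinder_prob rooting_law_cylinder -[X in X%:E]/(g (val (X w))).
  have Xin : val (X w) \in avs n by apply/mem_avs; exact: XA.
  rewrite (big_fsetD1 _ Xin)/= big_seq big1 => [|s].
    by rewrite adde0 indicE mem_set// mulr1.
  rewrite !inE => /andP[/eqP sX _]; rewrite indicE memNset ?mulr0//=.
  exact: nesym.
rewrite /Rintegral; under eq_integral do rewrite gE.
rewrite ge0_integral_sum//; last 2 first.
- move=> s; apply/measurable_EFinP => /=; apply: measurable_funM => //.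
- by move=> s w _; rewrite lee_fin mulr_ge0// divr_ge0.
rewrite big_seq.
under eq_bigr => s /mem_avs ns.
  rewrite (integralZl_indic _ (fun=> [set w | val (X w) = s]))//; last first.
    by move=> g0; have : 0 <= g s; [rewrite divr_ge0|rewrite leNgt g0].
  rewrite integral_indic//= setIT [P _](Xunif s ns).
  rewrite /g -EFinM (_ : (size (pword s))%:R = n%:R); last by rewrite ns.1.
  over.
rewrite -big_seq sumEFin /= -!mulr_suml -natr_sum -count_rooted_avs.
by rewrite natrM invfM mulrA.
Qed.

Lemma annealed_cvg d0 (T0 : measurableType d0) (P0 : probability T0 R)
  (sigma : nat -> {RV P0 >-> nonempty_perm})
  (sigma_unif : forall n, (0 < n)%N -> uniform_in P0 (Av231n n) (sigma n))
  (mu : probability (borel (rooted_space R)) R)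
  (sigma_cvg : quenched_BS_cvg P0 sigma mu) h U :
  (fun n => (count (in_cylinder h U) (rooted_avs n))%:R / (n * #|` avs n|)%:R : R)
    @ \oo --> fine (mu (cylinder h U)).
Proof.
have := sigma_cvg _ (@bounded_continuous_cylinder_prob R h U).
apply: cvg_trans; apply: near_eq_cvg; exists 1%N => // n /= n0.
by rewrite (integral_rooting_law _ _ n0 (sigma_unif n n0)).
Qed.

(** [descendants_density] is applied to the class [Q] of rooted permutations with a window in [U]
    and a spine of length at least [m]. Gluing preserves [Q] and makes the spine longer than [m],
    hence never lands in [F]. *)
Lemma spine_density d0 (T0 : measurableType d0) (P0 : probability T0 R)
  (sigma : nat -> {RV P0 >-> nonempty_perm})
  (sigma_unif : forall n, (0 < n)%N -> uniform_in P0 (Av231n n) (sigma n))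
  (mu : probability (borel (rooted_space R)) R)
  (sigma_cvg : quenched_BS_cvg P0 sigma mu) h U m (F : seq finite_rooted) :
  uniq F ->
  {in F, forall x, [/\ spine m x, avoids231 (projT1 x), window h x &
                     U (restr h (of_finite x))]} ->
  \sum_(x <- F) 4^-1 ^+ rsize x <= fine (mu (cylinder h U)) :> R.
Proof.
move=> uF FP.
pose Q : pred finite_rooted := fun x => [&& window h x, in_cylinder h U x &
  `[< exists2 k, (m <= k)%N & spine k x >]].
have acvg := @annealed_cvg _ _ _ sigma sigma_unif mu sigma_cvg h U.
apply: (@descendants_density R F Q _ _ uF _ _ _ _ acvg).
- move=> x /FP[sx ax wx Ux]; split=> //.
  by apply/and3P; split=> //; apply/asboolP => //; exists m.
- move=> b y p /and3P[wy Uy /asboolP[k mk sk]]; apply/and3P; split.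
  + exact: window_glue.
  + by rewrite /in_cylinder restr_glue.
  + by apply/asboolP; exists k.+1; [exact: leqW|exists b, y, p].
- move=> b y p /and3P[_ _ /asboolP[k mk sk]]; apply/negP => /FP[sg _ _ _].
  have := @spine_inj m k.+1 (glue b y p) sg; rewrite /= => mk'.
  have km : m = k.+1 by apply: mk'; exists b, y, p.
  by rewrite km ltnn in mk.
- by move=> x /and3P[].
Qed.

End annealed.

(** * The order on the integers as a limit *)

(** The result determines all the inputs it is built from, so the event that it takes a given value
    is an intersection of events on single inputs. *)
Lemma glue_iter_inj s0 s x s0' s' x' m :
  glue_iter s0 s x m = glue_iter s0' s' x' m <->
  s0 = s0' /\ forall i, (i < m)%N -> s i.+1 = s' i.+1 /\ x i = x' i.
Proof.
split=> [|[-> H]].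
  elim: m => [|m IHm] /=; first by move/root_at_max_inj => ->.
  move=> /glue_inj[xm /IHm[-> H] sm]; split=> // i.
  by rewrite ltnS leq_eqVlt => /orP[/eqP ->|/H].
elim: m H => [//|m IHm] H /=.
have [-> ->] := H m (ltnSn m).
by rewrite IHm// => i im; apply: H; exact: ltnW.
Qed.

Lemma spine_exists m z : spine m z -> exists s0 s x, z = glue_iter s0 s x m.
Proof.
elim: m z => [z [s0 _ <-]|m IHm z [b [y [p [/IHm[s0 [s [x ->]]] ->]]]]].
  by exists s0, (fun=> empty_perm), (fun=> true).
exists s0, (fun i => if i == m.+1 then p else s i), (fun i => if i == m then b else x i).
rewrite /= !eqxx; congr (glue _ _ _); apply/glue_iter_inj; split=> // i im.
by rewrite eqSS !ifN// neq_ltn im.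
Qed.

Lemma avoids231_glue b y p :
  avoids231 (projT1 (glue b y p)) <-> avoids231 (projT1 y) /\ avoids231 p.
Proof.
case: b y => -[s i]; first exact: avoids231_join_max.
rewrite /= -/(join_max p s : permutation).
by have := avoids231_join_max p s; tauto.
Qed.

Section limit_order.
Variables (s0 : nonempty_perm) (s : nat -> permutation) (x : nat -> bool).
Local Notation sg := (glue_iter s0 s x).

Lemma window_mono h m m' : (m <= m')%N -> window h (sg m) -> window h (sg m').
Proof.
move=> /subnKC <-; elim: (m' - m)%N => [|k IHk]; first by rewrite addn0.
by rewrite addnS => /IHk mk; exact: window_glue.
Qed.

Lemma rdom_mono m m' z : (m <= m')%N -> rdom (sg m) z -> rdom (sg m') z.
Proof.
move=> /subnKC <-; elim: (m' - m)%N => [|k IHk]; first by rewrite addn0.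
by rewrite addnS => /IHk mk; exact: rdom_glue.
Qed.

Lemma restr_stable h m m' : (m <= m')%N -> window h (sg m) ->
  restr h (of_finite (sg m')) = restr h (of_finite (sg m)).
Proof.
move=> /subnKC <- wm; elim: (m' - m)%N => [|k IHk]; first by rewrite addn0.
by rewrite addnS -IHk restr_glue//; apply: window_mono wm; exact: leq_addr.
Qed.

Lemma rle_stable m m' u v : (m <= m')%N -> rdom (sg m) u -> rdom (sg m) v ->
  rle (sg m') u v <-> rle (sg m) u v.
Proof.
move=> /subnKC <- mu mv; elim: (m' - m)%N => [|k IHk]; first by rewrite addn0.
rewrite addnS -IHk.
by apply: rle_glue; [apply: rdom_mono mu|apply: rdom_mono mv]; exact: leq_addr.
Qed.

Hypothesis windows : forall h, exists m, window h (sg m).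

(** One [m] is enough: by [rle_stable], any two stages agree on the positions that they share. *)
Definition lim_le (u v : int) : Prop := exists m, rle (sg m) u v.

Lemma rdom_ex (z : int) : exists m, rdom (sg m) z.
Proof.
by have [m /windowP H] := windows `|z|; exists m; apply: H; lia.
Qed.

Lemma lim_leE m u v : rdom (sg m) u -> rdom (sg m) v ->
  lim_le u v <-> rle (sg m) u v.
Proof.
move=> mu mv; split=> [[m' uv]|uv]; last by exists m.
have [] := uv => m'u m'v _.
apply/(rle_stable (leq_maxl m m')) => //.
by apply/(rle_stable (leq_maxr m m')).
Qed.

Lemma rdom_ex3 (u v z : int) :
  exists m, [/\ rdom (sg m) u, rdom (sg m) v & rdom (sg m) z].
Proof.
have [m mu] := rdom_ex u; have [n nv] := rdom_ex v; have [k kz] := rdom_ex z.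
exists (maxn m (maxn n k)); split;
  [apply: rdom_mono mu|apply: rdom_mono nv|apply: rdom_mono kz]; lia.
Qed.

Let dom0 : [set: int] 0. Proof. by []. Qed.
Let dom_itv (u v z : int) :
  [set: int] u -> [set: int] z -> u <= v <= z -> [set: int] v.
Proof. by []. Qed.
Let le_dom u v : lim_le u v -> [set: int] u /\ [set: int] v.
Proof. by []. Qed.
Let le_anti u v : lim_le u v -> lim_le v u -> u = v.
Proof.
have [m [mu mv _]] := rdom_ex3 u v u.
rewrite !(@lim_leE m)//; exact: (@rp_le_anti (of_finite (sg m))).
Qed.
Let le_tr u v z : lim_le u v -> lim_le v z -> lim_le u z.
Proof.
have [m [mu mv mz]] := rdom_ex3 u v z.
rewrite !(@lim_leE m)//; exact: (@rp_le_trans (of_finite (sg m))).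
Qed.
Let le_tot u v : [set: int] u -> [set: int] v -> lim_le u v \/ lim_le v u.
Proof.
have [m [mu mv _]] := rdom_ex3 u v u.
by rewrite !(@lim_leE m)// => _ _; exact: (@rp_le_total (of_finite (sg m))).
Qed.

Definition lim_order : rooted_perm :=
  RootedPerm dom0 dom_itv le_dom le_anti le_tr le_tot.

Lemma restr_lim_order h m : window h (sg m) ->
  restr h (of_finite (sg m)) = restr h lim_order.
Proof.
by move=> wm; apply: restr_window_eq => // u v mu mv; exact: iff_sym (lim_leE mu mv).
Qed.

Lemma restr_order231 (R : realType) h m : (0 < h)%N -> window h (sg m) ->
  restr h (order231 R s0 s x) = restr h (of_finite (sg m)).
Proof.
move=> h0 wm; rewrite /order231; case: xgetP => [y _ [ydom ylim]|/(_ lim_order)].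
  have [N _ Nlim] := ylim _ h0.
  rewrite -(Nlim (maxn N m) (leq_maxl N m)).
  by apply: restr_stable => //; exact: leq_maxr.
(* The default branch of [xget] is impossible, because [lim_order] is a limit. *)
case; split=> // k k0; have [n wn] := windows k.
exists n => // n' /= nn'; apply: restr_lim_order.
exact: window_mono nn' wn.
Qed.

End limit_order.

(** A limit with domain all of the integers would force some stage to have a window of width [h.+1].
    The order is then the constant default value, which keeps it measurable on the exceptional
    event. *)
Lemma order231_no_limit (R : realType) s0 s x h :
  (forall m, ~~ window h (glue_iter s0 s x m)) ->
  order231 R s0 s x = usual_order.
Proof.
move=> nw; rewrite /order231; case: xgetP => // y _ [ydom ylim].
have [N _ /(_ N (leqnn N)) E] := ylim h.+1 isT.
have : window h.+1 (glue_iter s0 s x N).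
  apply/windowP => z zh.
  have : rp_dom (restr h.+1 y) z by split=> //; rewrite ydom.
  by rewrite -E => -[].
have := nw N; rewrite /window; lia.
Qed.

Lemma windows_of_coins s0 s x :
  (forall b k, exists2 i, (k <= i)%N & x i = b) ->
  forall h, exists m, window h (glue_iter s0 s x m).
Proof.
move=> Hx; set sg := glue_iter s0 s x.
(* [ext true] counts the entries from the root on, root included, and [ext false] those before it;
   this is why the bounds below are [h.+1] and [h]. Each coin equal to [b] increases [ext b]. *)
pose ext b m : nat := if b then (rsize (sg m) - projT2 (sg m))%N else projT2 (sg m).
have extS b m : (ext b m + (x m == b) <= ext b m.+1)%N.
  rewrite /ext /sg /= rsize_glue glue_root.
  have := ltn_ord (projT2 (glue_iter s0 s x m)); rewrite -/(rsize _).
  by case: b; case: (x m) => /=; lia.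
have ext_mono b m m' : (m <= m')%N -> (ext b m <= ext b m')%N.
  move=> /subnKC <-; elim: (m' - m)%N => [|k IHk]; first by rewrite addn0.
  apply: leq_trans IHk _; rewrite addnS.
  exact: leq_trans (leq_addr _ _) (extS b _).
have ext_large b h : exists m, (h <= ext b m)%N.
  elim: h => [|h [m hm]]; first by exists 0%N.
  have [i mi xi] := Hx b m; exists i.+1.
  apply: leq_trans (extS b i); rewrite xi eqxx addn1 ltnS.
  exact: leq_trans hm (ext_mono b _ _ mi).
move=> h; have [m hm] := ext_large true h.+1; have [n hn] := ext_large false h.
exists (maxn m n); rewrite /window.
have := leq_trans hm (ext_mono true _ _ (leq_maxl m n)).
have := leq_trans hn (ext_mono false _ _ (leq_maxr m n)).
by rewrite /ext -/sg; lia.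
Qed.

(** * The law of the construction *)

Lemma Av231P (s : permutation) : Av231 s <-> pword s <> [::] /\ avoids231 s.
Proof.
split=> [[n /= n0 [sn av]]|[s0 av]].
  by split=> // s0; rewrite -sn s0 in n0.
by exists (size s) => //=; rewrite lt0n size_eq0; exact/eqP.
Qed.

Section probability_lemmas.
Context (R : realType) d (T : measurableType d) (P : probability T R).

Lemma le_probability_bigcup (F : (set T)^nat) (p : \bar R) :
  (forall n, measurable (F n)) ->
  {homo F : m n / (m <= n)%N >-> m `<=` n} ->
  (forall n, (P (F n) <= p)%E) -> (P (\bigcup_n F n) <= p)%E.
Proof.
move=> mF Fhomo Fp.
have Fcvg : P \o F @ \oo --> P (\bigcup_n F n).
  apply: nondecreasing_cvg_mu => //; first exact: bigcupT_measurable.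
  by move=> m n mn; rewrite subsetEset; exact: Fhomo.
rewrite -(cvg_lim _ Fcvg)//; apply: lime_le; first by apply/cvg_ex; eexists; exact: Fcvg.
exact: nearW.
Qed.

Lemma le_probability_null (A B N : set T) :
  measurable A -> measurable B -> measurable N -> P N = 0%E ->
  A `<=` B `|` N -> (P A <= P B)%E.
Proof.
move=> mA mB mN N0 AB; rewrite -(measureU0 mB mN N0).
by apply: le_measure => //; rewrite inE//; exact: measurableU.
Qed.

End probability_lemmas.

Section construction.
Context (R : realType) d (T : measurableType d) (P : probability T R).
Variables (S : nat -> {RV P >-> permutation}) (X : nat -> {RV P >-> bool}).
Variable (S0 : {RV P >-> nonempty_perm}).
Hypothesis S_law : forall i, law_S P (S i).
Hypothesis X_law : forall i, fair_coin P (X i).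
Hypothesis S0_law : conditioned_nonempty P (S 0%N) S0.
Hypothesis indep : independent P (fun k : option (nat + nat) =>
  match k with
  | None => generated S0
  | Some (inl i) => generated (S i.+1)
  | Some (inr i) => generated (X i)
  end).

Let sg m w := glue_iter (S0 w) (fun i => S i w) (fun i => X i w) m.

(** The last coin and the last glued permutation range over a countable type. Fixing their values
    [u] leaves an event on the previous iterate, with another [Q]. *)
Lemma measurable_glue_iter m (Q : set finite_rooted) :
  measurable [set w | Q (sg m w)].
Proof.
elim: m Q => [|m IHm] Q.
  exact: (@measurable_mfun_preimage _ _ _ _ S0 [set t | Q (root_at_max t)]).
rewrite (_ : [set w | _] = \bigcup_(u : bool * permutation)
    ([set w | Q (glue u.1 (sg m w) u.2)] `&`
     (X m @^-1` [set u.1] `&` S m.+1 @^-1` [set u.2]))).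
  apply: countable_bigcupT_measurable => [|u]; first exact: countableP.
  apply: measurableI; first exact: (IHm [set y | Q (glue u.1 y u.2)]).
  by apply: measurableI; exact: measurable_mfun_preimage.
apply/seteqP; split=> [w Qw|w [[b p] _ [/= Qw [Xb Sp]]]].
  by exists (X m w, S m.+1 w).
by rewrite /sg /= Xb Sp.
Qed.

Lemma prob_S i (p : permutation) : avoids231 p ->
  P (S i @^-1` [set p]) = (2^-1 * 4^-1 ^+ size p)%:E.
Proof.
move=> av; have [_ S1 S0'] := S_law i.
have [p0|p0] := pselect (pword p = [::]); last by apply: S1; exact/Av231P.
by rewrite (_ : p = empty_perm) ?mulr1 //; exact: permutation_eq.
Qed.

Lemma prob_X i b : P (X i @^-1` [set b]) = (2^-1)%:E.
Proof. by have [Xt Xf] := X_law i; case: b; [exact: Xt|exact: Xf]. Qed.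

Lemma prob_S_nonempty : P [set w | S 0%N w <> empty_perm] = (2^-1)%:E.
Proof.
have [_ _ S0'] := S_law 0.
rewrite (_ : [set w | _] = ~` (S 0%N @^-1` [set empty_perm]))//.
rewrite probability_setC; last exact: measurable_mfun_preimage.
by rewrite [P _]S0' -EFinB; congr (_%:E); lra.
Qed.

(** Conditioning on non-emptiness divides by [2^-1], which cancels the same factor in the law of
    [S 0]. *)
Lemma prob_S0 (s : nonempty_perm) : avoids231 (val s) ->
  P (S0 @^-1` [set s]) = (4^-1 ^+ size (val s))%:E.
Proof.
move=> av; have := S0_law [set val s]; rewrite prob_S_nonempty /=.
rewrite (_ : [set w | _ = _] = S0 @^-1` [set s]); last first.
  by apply/seteqP; split=> w /= => [/val_inj|->].
rewrite (_ : [set w | _ /\ _] = S 0%N @^-1` [set val s]); last first.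
  apply/seteqP; split=> w /= => [[]//|->]; split=> // s0.
  by have := valP s; rewrite /= s0.
move=> ->; rewrite prob_S// /=; congr (_%:E).
by rewrite invrK mulrAC mulVf ?mul1r// pnatr_eq0.
Qed.

(** [conditioned_nonempty] constrains only the law of [S0], so avoidance is almost sure here,
    whereas [law_S] gives it at every outcome. *)
Lemma S0_avoids : P [set w | ~ avoids231 (val (S0 w))] = 0%E.
Proof.
rewrite (S0_law [set s | ~ avoids231 s]) (_ : [set w | _ /\ _] = set0).
  by rewrite measure0 /= mul0r.
apply/seteqP; split=> // w [/= nav ne]; have [/(_ w) SA _ _] := S_law 0.
by case: SA => // /Av231P[].
Qed.

Lemma S_avoids i w : avoids231 (S i w).
Proof.
have [/(_ w) [/Av231P[]//|-> _ _ a b c _]] := S_law i.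
by [].
Qed.

Fixpoint input_indices m : {fset option (nat + nat)} :=
  if m is k.+1 then (Some (inl k) |` (Some (inr k) |` input_indices k))%fset
  else [fset None]%fset.

Lemma mem_input_indices m k : (k \in input_indices m) =
  match k with None => true | Some (inl i) | Some (inr i) => (i < m)%N end.
Proof.
elim: m => [|m IHm] /=; first by rewrite inE; case: k => [[]|].
rewrite !inE IHm; case: k {IHm} => [[i|i]|]//=; rewrite ltnS [RHS]leq_eqVlt;
  by congr (_ || _); apply/eqP/eqP => [[]|->].
Qed.

(** The event factors over independent inputs. A gluing of [p] adds [size p + 1] entries and
    contributes [2^-1] for the coin times [2^-1 * 4^-1 ^+ size p] for [p], that is, one factor
    [4^-1] per new entry. *)
Lemma prob_glue_iter m s0 s x :
  avoids231 (projT1 (glue_iter s0 s x m)) ->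
  P [set w | sg m w = glue_iter s0 s x m] =
  (4^-1 ^+ rsize (glue_iter s0 s x m))%:E.
Proof.
move=> av.
pose A (k : option (nat + nat)) : set T :=
  match k with
  | None => S0 @^-1` [set s0]
  | Some (inl i) => S i.+1 @^-1` [set s i.+1]
  | Some (inr i) => X i @^-1` [set x i]
  end.
rewrite (_ : [set w | _] = \bigcap_(k in [set` input_indices m]) A k); last first.
  apply/seteqP; split=> w.
    move=> /glue_iter_inj[s0w H] k /=; rewrite mem_input_indices /A.
    by case: k => [[i|i]|]// im; have [] := H i im.
  move=> H; apply/glue_iter_inj; split.
    by have := H None; rewrite /= mem_input_indices; apply.
  move=> i im; split.
    by have := H (Some (inl i)); rewrite /= mem_input_indices; apply.
  by have := H (Some (inr i)); rewrite /= mem_input_indices; apply.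
rewrite indep; last first.
  by move=> [[i|i]|] _; [exists [set s i.+1]|exists [set x i]|exists [set s0]].
elim: m av => [|m IHm] /=; first by move=> av; rewrite big_seq_fset1 prob_S0.
move=> /avoids231_glue[avm avs_].
rewrite !big_fsetU1; last 2 first.
- by rewrite mem_input_indices ltnn.
- by rewrite !inE mem_input_indices ltnn.
rewrite /= prob_S// prob_X IHm// -!EFinM; congr (_%:E).
rewrite rsize_glue exprS addnC exprD; lra.
Qed.

Lemma prob_spine m z : spine m z -> avoids231 (projT1 z) ->
  P [set w | sg m w = z] = (4^-1 ^+ rsize z)%:E.
Proof.
by move=> /spine_exists[s0 [s [x ->]]]; exact: prob_glue_iter.
Qed.

Lemma glue_iter_avoids m w : avoids231 (val (S0 w)) ->
  avoids231 (projT1 (sg m w)).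
Proof.
move=> av; elim: m => [//|m IHm].
by apply/avoids231_glue; split=> //; exact: S_avoids.
Qed.

Lemma prob_spine_seq m (F : seq finite_rooted) : uniq F ->
  {in F, forall z, spine m z /\ avoids231 (projT1 z)} ->
  P [set w | sg m w \in F] = (\sum_(z <- F) 4^-1 ^+ rsize z)%:E.
Proof.
elim: F => [_ _|z F IHF /= /andP[zF uF] FP].
  rewrite big_nil (_ : [set w | _] = set0) ?measure0//.
  by apply/seteqP; split.
rewrite (_ : [set w | _] = [set w | sg m w = z] `|` [set w | sg m w \in F]).
  rewrite measureU; first last.
  - by apply/seteqP; split=> // w [/= ->]; apply/negP.
  - exact: (measurable_glue_iter m [set y | y \in F]).
  - exact: (measurable_glue_iter m [set y | y = z]).
  have [sz az] := FP z (mem_head _ _).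
  rewrite big_cons EFinD; congr (_ + _)%E; first exact: prob_spine.
  by apply: IHF => // y yF; apply: FP; rewrite inE yF orbT.
apply/seteqP; split=> w /=; rewrite inE; first by case/orP => [/eqP|]; [left|right].
by case=> [->|->]; rewrite ?eqxx ?orbT.
Qed.

Fixpoint coin_indices k m : {fset option (nat + nat)} :=
  if m is j.+1 then (Some (inr (k + j)%N) |` coin_indices k j)%fset else fset0.

Lemma mem_coin_indices k m j : j \in coin_indices k m ->
  exists2 i, (k <= i < k + m)%N & j = Some (inr i).
Proof.
elim: m => [|m IHm] //=; rewrite !inE => /orP[/eqP ->|/IHm[i ikm ->]].
  by exists (k + m)%N => //; lia.
by exists i => //; lia.
Qed.

(** For every [m], the event is contained in the one that [m] given coins equal [b], of probability
    [2^-1 ^+ m]. *)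
Lemma constant_tail_null b k :
  P (\bigcap_(i in [set i | (k <= i)%N]) X i @^-1` [set b]) = 0%E.
Proof.
set N := \bigcap_(i in _) _.
have mN : measurable N.
  by apply: bigcap_measurable => [|i _]; [exists k => /=|exact: measurable_mfun_preimage].
pose A (j : option (nat + nat)) : set T :=
  if j is Some (inr i) then X i @^-1` [set b] else setT.
have mA j : measurable (A j).
  by case: j => [[i|i]|] //=; exact: measurable_mfun_preimage.
have PN m : (P N <= (2^-1 ^+ m)%:E)%E.
  have -> : (2^-1 ^+ m)%:E = P (\bigcap_(j in [set` coin_indices k m]) A j).
    rewrite indep.
      elim: m => [|m IHm] /=; first by rewrite big_seq_fset0.
      rewrite big_fsetU1 /= -?IHm ?prob_X; first by rewrite exprS EFinM.
      by apply/negP => /mem_coin_indices[i ikm [ki]]; lia.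
    by move=> j /mem_coin_indices[i _ ->]; exists [set b].
  apply: le_measure; rewrite ?inE//.
    by apply: fin_bigcap_measurable => //; exact: finite_fset.
  move=> w Nw j /= /mem_coin_indices[i /andP[ki _] ->] /=.
  exact: Nw.
apply/eqP; rewrite eq_le measure_ge0 andbT leNgt; apply/negP => N0.
have Nfin : P N \is a fin_num by exact: fin_num_measure.
have [m] : exists m : nat, 2^-1 ^+ m.+1 < fine (P N).
  by apply: exists_half_expn_lt; rewrite -lte_fin fineK.
by rewrite -lte_fin fineK// ltNge PN.
Qed.

Definition windowless : set T := [set w | ~ forall h, exists m, window h (sg m w)].

Lemma measurable_windowless : measurable windowless.
Proof.
rewrite (_ : windowless = ~` \bigcap_h \bigcup_m [set w | window h (sg m w)]).
  apply: measurableC; apply: bigcapT_measurable => h.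
  by apply: bigcupT_measurable => m; exact: (measurable_glue_iter m [set y | window h y]).
apply/seteqP; split=> w /= H K; apply: H => h.
  by have [m _ hm] := K h I; exists m.
by move=> _; have [m hm] := K h; exists m.
Qed.

Lemma windowless_null : P windowless = 0%E.
Proof.
apply: measure_negligible; first exact: measurable_windowless.
pose N b := \bigcup_k \bigcap_(i in [set i | (k <= i)%N]) X i @^-1` [set b].
apply: (@negligibleS _ _ _ _ (N true `|` N false)); last first.
  suff neg b : P.-negligible (N b) by exact: negligibleU.
  apply: negligible_bigcup => k; apply/negligibleP; last exact: constant_tail_null.
  by apply: bigcap_measurable => [|i _]; [exists k => /=|exact: measurable_mfun_preimage].
(* Without windows, some side [b] no longer occurs from some [k] on, so the coins are constantly
   [~~ b] from there. *)
move=> w nw; apply: contrapT => nN; apply: nw; apply: windows_of_coins => b k.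
apply: contrapT => nex; apply: nN.
have : N (~~ b) w.
  exists k => // i ki; apply: contrapT => Xb; apply: nex; exists i => //.
  by move: Xb; rewrite /preimage /=; case: (X i w); case: (b).
by case: (b); [right|left].
Qed.

Local Notation ord w := (order231 R (S0 w) (fun i => S i w) (fun i => X i w)).

(** The event is expressed exactly through the finite stages, including on [windowless], as
    measurability cannot be checked up to null sets in a space not assumed complete. *)
Lemma order231_cylinderE h U : (0 < h)%N ->
  [set w | cylinder h U (ord w)] =
  ((\bigcup_m [set w | window h (sg m w) /\ U (restr h (of_finite (sg m w)))])
     `\` windowless)
  `|` (windowless `&` [set w | cylinder h U (usual_order : borel (rooted_space R))]).
Proof.
move=> h0; apply/seteqP; split=> w.
  have [ww|ww] := pselect (windowless w).
    move=> Uw; right; split=> //; move: ww; rewrite /windowless /= => /existsNP[k kw].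
    move: Uw; rewrite /= (@order231_no_limit R _ _ _ k)// => m.
    by apply/negP => km; apply: kw; exists m.
  move=> Uw; left; split=> //.
  have {}ww := contrapT ww; have [m hm] := ww h.
  by exists m => //; split=> //; rewrite -(restr_order231 ww R h0 hm).
case=> [[[m _ [hm Um]] ww]|[ww Uu]].
  have {}ww := contrapT ww.
  by rewrite /= /cylinder /= (restr_order231 ww R h0 hm).
have /existsNP[k kw] := ww.
rewrite /= (@order231_no_limit R _ _ _ k)// => m.
by apply/negP => km; apply: kw; exists m.
Qed.

Lemma measurable_order231_cylinder h U : (0 < h)%N ->
  measurable [set w | cylinder h U (ord w)].
Proof.
move=> h0; rewrite order231_cylinderE//.
have mW := measurable_windowless.
apply: measurableU.
  apply: measurableD => //; apply: bigcupT_measurable => m.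
  exact: (measurable_glue_iter m [set y | window h y /\ U (restr h (of_finite y))]).
apply: measurableI => //.
have [Uu|Uu] := pselect (cylinder h U (usual_order : borel (rooted_space R))).
  by rewrite (_ : [set w | _] = setT)//; apply/seteqP; split.
by rewrite (_ : [set w | _] = set0)//; apply/seteqP; split.
Qed.

(** Two increasing unions reduce the event to finite ones: first over the stage [m] at which the
    window is present, then over finite sets of values of that stage. [prob_spine_seq] turns each
    into a sum bounded by [p]. *)
Lemma order231_cylinder_le h U (p : R) : (0 < h)%N ->
  (forall m (F : seq finite_rooted), uniq F ->
     {in F, forall x, [/\ spine m x, avoids231 (projT1 x), window h x &
                        U (restr h (of_finite x))]} ->
     \sum_(x <- F) 4^-1 ^+ rsize x <= p) ->
  (P [set w | cylinder h U (ord w)] <= p%:E)%E.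
Proof.
move=> h0 Fp; pose Q y := window h y /\ U (restr h (of_finite y)).
have mG m : measurable [set w | Q (sg m w)] by exact: measurable_glue_iter.
apply: (@le_trans _ _ (P (\bigcup_m [set w | Q (sg m w)]))).
  apply: (le_probability_null (N := windowless)).
  - exact: measurable_order231_cylinder.
  - exact: bigcupT_measurable.
  - exact: measurable_windowless.
  - exact: windowless_null.
  - by rewrite order231_cylinderE// => w [[]|[]]; [left|right].
apply: le_probability_bigcup => //.
  move=> m n mn w /= [wm Um]; split; first exact: window_mono mn wm.
  by rewrite (restr_stable mn wm).
move=> m.
(* Bounding the code [pickle] by [k] leaves finitely many values, listed in [F] below. *)
pose H k := [set w | Q (sg m w) /\ avoids231 (projT1 (sg m w)) /\
                    (choice.pickle (sg m w) < k)%N].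
have mH k : measurable (H k).
  exact: (measurable_glue_iter m
    [set y | Q y /\ avoids231 (projT1 y) /\ (choice.pickle y < k)%N]).
apply: (@le_trans _ _ (P (\bigcup_k H k))).
  apply: (le_probability_null (N := [set w | ~ avoids231 (val (S0 w))])) => //.
  - exact: bigcupT_measurable.
  - exact: (@measurable_mfun_preimage _ _ _ _ S0
      [set s : nonempty_perm | ~ avoids231 (val s)]).
  - exact: S0_avoids.
  - move=> w Qw; have [av|nav] := pselect (avoids231 (val (S0 w))); last by right.
    left; exists (choice.pickle (sg m w)).+1 => //; split=> //; split=> //.
    exact: glue_iter_avoids.
apply: le_probability_bigcup => //.
  by move=> k l kl w [Qw [aw wk]]; split=> //; split=> //; exact: leq_trans kl.
move=> k.
pose F := [seq z <- pmap (@choice.pickle_inv finite_rooted) (iota 0 k) |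
  `[< [/\ spine m z, avoids231 (projT1 z) & Q z] >]] : seq finite_rooted.
have uF : uniq F.
  by rewrite filter_uniq// (pmap_uniq (@choice.pickle_invK _))// iota_uniq.
have FP z : z \in F -> [/\ spine m z, avoids231 (projT1 z) & Q z].
  by rewrite mem_filter => /andP[/asboolP].
apply: (@le_trans _ _ (P [set w | sg m w \in F])).
  apply: le_measure; rewrite ?inE//.
    exact: (measurable_glue_iter m [set y | y \in F]).
  move=> w [Qw [aw wk]]; rewrite /= mem_filter; apply/andP; split.
    by apply/asboolP; split=> //; exact: spine_glue_iter.
  rewrite mem_pmap; apply/mapP; exists (choice.pickle (sg m w)).
    by rewrite mem_iota.
  by rewrite choice.pickleK_inv.
rewrite prob_spine_seq//; last by move=> z /FP[].
by rewrite lee_fin; apply: (Fp m) => // z /FP[? ? []].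
Qed.

End construction.

(** * Equality of the laws *)

(* The inequality applied to a cylinder and to its complement. *)
Lemma cylinder_prob_eq (R : realType) d1 d2 (T1 : measurableType d1)
    (T2 : measurableType d2) (P1 : probability T1 R) (P2 : probability T2 R)
    (f1 : T1 -> borel (rooted_space R)) (f2 : T2 -> borel (rooted_space R)) h :
  (forall U, measurable (f1 @^-1` cylinder h U)) ->
  (forall U, measurable (f2 @^-1` cylinder h U)) ->
  (forall U, P2 (f2 @^-1` cylinder h U) <= P1 (f1 @^-1` cylinder h U))%E ->
  forall U, P2 (f2 @^-1` cylinder h U) = P1 (f1 @^-1` cylinder h U).
Proof.
move=> m1 m2 le21 U; apply/eqP; rewrite eq_le le21 /=.
have := le21 (~` U).
rewrite -[f1 @^-1` _]/(~` (f1 @^-1` cylinder h U)).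
rewrite -[f2 @^-1` _]/(~` (f2 @^-1` cylinder h U)).
rewrite (probability_setC P1 (m1 U)) (probability_setC P2 (m2 U)).
have fin1 := fin_num_measure P1 _ (m1 U).
have fin2 := fin_num_measure P2 _ (m2 U).
rewrite -(fineK fin1) -(fineK fin2) -!EFinB !lee_fin; lra.
Qed.

Theorem proposition4p29 (R : realType)
  (* uniform permutations in Av^n(231), n >= 1 *)
  (d0 : measure_display) (T0 : measurableType d0) (P0 : probability T0 R)
  (sigma : nat -> {RV P0 >-> nonempty_perm})
  (sigma_unif : forall n, (0 < n)%N -> uniform_in P0 (Av231n n) (sigma n))
  (* sigma^infty_231, whose law is their quenched limit *)
  (d1 : measure_display) (T1 : measurableType d1) (P1 : probability T1 R)
  (sigma_inf : {RV P1 >-> borel (rooted_space R)})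
  (sigma_inf_infinite : forall w, infinite_set (rp_dom (sigma_inf w)))
  (sigma_cvg : quenched_BS_cvg P0 sigma (distribution P1 sigma_inf))
  (* the random inputs of the construction; X i is X_{i+1} *)
  (d2 : measure_display) (T2 : measurableType d2) (P2 : probability T2 R)
  (S : nat -> {RV P2 >-> permutation}) (X : nat -> {RV P2 >-> bool})
  (S0_ne : {RV P2 >-> nonempty_perm})
  (S_law : forall i, law_S P2 (S i))
  (X_law : forall i, fair_coin P2 (X i))
  (S_X_indep : independent P2 (fun k : nat + nat =>
     match k with
     | inl i => generated (S i)
     | inr i => generated (X i)
     end))
  (S0_ne_law : conditioned_nonempty P2 (S 0%N) S0_ne)
  (S0_ne_indep : independent P2 (fun k : option (nat + nat) =>
     match k with
     | None => generated S0_ne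
     | Some (inl i) => generated (S i.+1)
     | Some (inr i) => generated (X i)
     end)) :
  eq_in_distribution P2 P1
    (fun w => order231 R (S0_ne w) (fun i => S i w) (fun i => X i w))
    sigma_inf.
Proof.
have mcyl h U : measurable ((fun w => order231 R (S0_ne w) (fun i => S i w)
    (fun i => X i w)) @^-1` cylinder h U).
  (* A cylinder of width [h] is also one of width [h.+1]; this covers [h = 0], as the lemmas on
     [order231] require a positive width. *)
  rewrite (cylinder_le R U (leqnSn h)).
  exact: (@measurable_order231_cylinder R _ _ P2 S X S0_ne h.+1).
set f := fun w => _ in mcyl *.
have mf : measurable_fun setT f.
  apply: (measurability (@cylinders R)); first exact: borel_cylinders.
  by move=> _ [_ [h [U ->]] <-]; rewrite setTI; exact: mcyl.
have minf h U : measurable (sigma_inf @^-1` cylinder h U).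
  by apply: measurable_mfun_preimage; exact: measurable_cylinder.
have le_cyl h U : (P2 (f @^-1` cylinder h U) <= P1 (sigma_inf @^-1` cylinder h U))%E.
  rewrite (cylinder_le R U (leqnSn h)).
  rewrite -[leRHS]fineK ?fin_num_measure//.
  apply: (order231_cylinder_le S_law X_law S0_ne_law S0_ne_indep) => // m F uF FP.
  exact: (spine_density sigma_unif sigma_cvg uF FP).
split=> //.
pose fRV : {RV P2 >-> borel (rooted_space R)} :=
  HB.pack f (isMeasurableFun.Build _ _ _ _ f mf).
(* Two probability measures that agree on a generating pi-system are equal; the covering sequence it
   asks for is constantly the whole space, itself a cylinder. *)
apply: (@measure_unique _ R _ (@cylinders R) (fun=> setT) _ _ _ _
  (distribution P2 fRV) (distribution P1 sigma_inf)).
- exact: borel_cylinders.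
- exact: setI_closed_cylinders.
- by move=> _; exists 0%N, setT.
- by rewrite bigcup_const//; exists 0%N.
- move=> _ [h [U ->]].
  exact: (cylinder_prob_eq (f1 := sigma_inf) (f2 := f) (minf h) (mcyl h) (le_cyl h)).
- by move=> _; apply: le_lt_trans (probability_le1 _ _) _; rewrite ?ltry.
Qed.
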